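(* Let $(B,\Delta,\epsilon,\int)$ be a scaled Rota-Baxter bialgebra over $K$. Then $(\mathfrak H(B),\int^{x_n})_{n\ge1}$, with the operators $\int^{x_n}=\mathrm{id}^{\otimes(n-1)}\otimes\int$, is a Rota-Baxter hierarchy over $K$.
   Context: $K$ is a field of characteristic zero. All $K$-algebras are commutative and unital; all bialgebras are commutative and cocommutative. Rota-Baxter operators have weight zero: a $K$-linear operator $P$ with $P(u)P(v)=P(uP(v))+P(P(u)v)$. A Rota-Baxter algebra $(G,P)$ over a ring $R\supseteq\mathbb Q$ ($P$ being $R$-linear) is ordinary if $P$ is injective and $G=R\oplus\operatorname{im}P$ as $R$-modules; its associated evaluation is the projector onto $R$ along $\operatorname{im}P$. Matrices. $\mathcal M(K)$ is the monoid of infinite matrices (indexed by $1,2,\dots$) of the form $I+\tilde M$ with $\tilde M$ having finitely many nonzero rows and columns; $M\in\mathcal M_n(K)=K^{n\times n}$ is identified with $\mathrm{diag}(M,I)$. $\tilde{\mathcal M}_m(K)=\{\mathrm{diag}(I_m,M): M\in\mathcal M(K)\}$. $E_n:=I-e_{nn}$. A scalar $\lambda$ is identified with $\mathrm{diag}(\lambda,1,1,\dots)$. $T_1(e_1):=I+e_{12}$. For $w=(w_{i+1},\dots,w_n)^{\top}\in K^{n-i}$, $L_i(w):=I+\sum_{k>i}w_ke_{ki}$, so $L_i^{-1}(w)=L_i(-w)$; unit vectors $e_k\in K^{n-i}$ are numbered by position. For $M\in\mathcal M(K)$, $M_{\lrcorner n}$ has the same first $n$ rows as $M$ and further rows $e_{n+1},e_{n+2},\dots$.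 $K$-hierarchy. An ascending sequence of $K$-algebras $K=\mathcal F_0\subseteq\mathcal F_1\subseteq\cdots$ with union $\mathcal F$, together with a contravariant monoid action of $\mathcal M(K)$ on $\mathcal F$ by $K$-algebra endomorphisms $M^*$ ($I^*=\mathrm{id}$, $(MN)^*=N^*M^*$) that is straight ($M^*f=M_{\lrcorner n}^*f$ for $f\in\mathcal F_n$) and satisfies $M^*(\mathcal F_n)\subseteq\mathcal F_n$ for $M\in\mathcal M_n(K)$ and $E_n^*(\mathcal F_n)\subseteq\mathcal F_{n-1}$. Rota-Baxter hierarchy. A $K$-hierarchy with commuting Rota-Baxter operators $\int^{x_n}:\mathcal F\to\mathcal F$ ($n\ge1$) such that: (a) for $n\le m$, $\int^{x_n}\mathcal F_m\subseteq\mathcal F_m$ and $\int^{x_n}M^*=M^*\int^{x_n}$ for all $M\in\tilde{\mathcal M}_m(K)$; (b) every $(\mathcal F_n,\int^{x_n})$ is an ordinary Rota-Baxter algebra over $\mathcal F_{n-1}$ with evaluation $E_n^*$; (c) $\tau^*\int^{x_i}=\int^{x_j}\tau^*$ for the transposition matrix $\tau=(i\;j)$; (d) for $\lambda\in K\setminus\{0\}$ and $v=(0,v')\in K\oplus K^{n-2}$: $\int^{x_1}\lambda^*=\lambda^{-1}\lambda^*\int^{x_1}$; $\int^{x_1}T_1(e_1)^*=(1-E_1^* )T_1(e_1)^*\int^{x_1}$; and $\int^{x_1}L_1(e_1+v)^*\int^{x_1}=L_2^{-1}(v')^*\,[L_1(e_1)^*,\int^{x_1}]\,\int^{x_2}L_2(v')^*$,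 where $[S,T]=ST-TS$. Scaled Rota-Baxter bialgebra. Let $(B,\Delta,\epsilon)$ be a $K$-bialgebra with product $\nabla$, unit $1$; put $\mathsf e:=1\circ\epsilon$ and $f\oplus g:=\nabla(f\otimes g)\Delta$ for linear endomorphisms. $(B,\Delta,\epsilon,\int)$ is a Rota-Baxter bialgebra if $(B,\int)$ is an ordinary Rota-Baxter algebra over $K$, $\mathsf e$ is the projector onto $K$ along $\operatorname{im}\int$, and $\Delta\int=(\int\otimes\mathrm{id})\Delta+(\mathsf e\otimes\mathrm{id})\Delta\int$. It is scaled if there is also a scaling $\lambda\mapsto\lambda^*$, i.e. a monoid homomorphism from $(K\setminus\{0\},\cdot)$ to bialgebra endomorphisms of $B$ such that, with $0^*:=\mathsf e$, $\lambda\mapsto\lambda^*$ is a semiring homomorphism $(K,+,\cdot)\to(\text{bialgebra endomorphisms},\oplus,\circ)$, and $\int\lambda^*=\lambda^{-1}\lambda^*\int$ for $\lambda\ne0$. Induced hierarchy $\mathfrak H(B)$. $B_0=K$, $B_n=B^{\otimes n}$ embedded in $B_{n+1}$ by $f\mapsto f\otimes1$; $\mathfrak H(B)$ is the direct limit. With $\Delta^1=\mathrm{id}$, $\Delta^{n+1}=(\Delta^n\otimes\mathrm{id})\Delta$ and, for a row $a\in K^n$, $a^*:=(a_1^*\otimes\cdots\otimes a_n^* )\Delta^n:B\to B_n$, the matrix $M\in\mathcal M_n(K)$ acts on $B_n$ by $M^*(f_1\otimes\cdots\otimes f_n)=(M_{1\bullet}^*f_1)\cdots(M_{n\bullet}^*f_n)$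 (product in $B_n$, $M_{i\bullet}$ the rows of $M$); this gives the action of $\mathcal M(K)$ on $\mathfrak H(B)$. The operator $\int^{x_n}$ acts on $B_m$, $m\ge n$, as $\mathrm{id}^{\otimes(n-1)}\otimes\int\otimes\mathrm{id}^{\otimes(m-n)}$. *)

(* Defs.v *)
From HB Require Import structures.
From mathcomp Require Import all_boot all_algebra.
From mathcomp Require Import boolp classical_sets cardinality fsbigop.

Set Implicit Arguments.
Unset Strict Implicit.
Unset Printing Implicit Defensive.

Import GRing.Theory.
Local Open Scope classical_set_scope.
Local Open Scope ring_scope.

(* A tensor is a finite formal sum of pairs, modulo the congruence          *)
(* generated by bilinearity.                                                *)

Section TensorModule.
Variables (K : fieldType) (V W : lmodType K).
Implicit Types (s t : seq (V * W)) (v : V) (w : W) (a : K).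

Inductive tens_eq : seq (V * W) -> seq (V * W) -> Prop :=
| TensRefl s : tens_eq s s
| TensSym s t : tens_eq s t -> tens_eq t s
| TensTrans s t u : tens_eq s t -> tens_eq t u -> tens_eq s u
| TensCat s1 t1 s2 t2 :
    tens_eq s1 t1 -> tens_eq s2 t2 -> tens_eq (s1 ++ s2) (t1 ++ t2)
| TensCatC s t : tens_eq (s ++ t) (t ++ s)
| TensDl v v' w : tens_eq [:: (v + v', w)] [:: (v, w); (v', w)]
| TensDr v w w' : tens_eq [:: (v, w + w')] [:: (v, w); (v, w')]
| TensZ a v w : tens_eq [:: (a *: v, w)] [:: (v, a *: w)]
| Tens0 : tens_eq [:: (0, 0)] [::].

Definition tens_eqb : rel (seq (V * W)) := fun s t => `[< tens_eq s t >].

Lemma tens_eqb_refl : reflexive tens_eqb.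
Proof. by move=> s; apply/asboolP; exact: TensRefl. Qed.
Lemma tens_eqb_sym : symmetric tens_eqb.
Proof. by move=> s t; apply/asboolP/asboolP; exact: TensSym. Qed.
Lemma tens_eqb_trans : transitive tens_eqb.
Proof.
by move=> t s u /asboolP st /asboolP tu; apply/asboolP; exact: TensTrans st tu.
Qed.

Canonical tens_equiv :=
  EquivRel tens_eqb tens_eqb_refl tens_eqb_sym tens_eqb_trans.

Definition tensor : Type := {eq_quot tens_equiv}%qT.
HB.instance Definition _ := Choice.on tensor.

Definition tens_class s : tensor := (\pi_({eq_quot tens_equiv}) s)%qT.
Definition tens_repr (x : tensor) : seq (V * W) :=
  @repr _ {eq_quot tens_equiv}%qT x.

Lemma tens_reprK : cancel tens_repr tens_class.
Proof. exact: (@reprK _ {eq_quot tens_equiv}%qT). Qed.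

Lemma tens_classP s t : tens_class s = tens_class t <-> tens_eq s t.
Proof.
split; first by move=> /eqP; rewrite /tens_class eqmodE => /asboolP.
by move=> st; apply/eqP; rewrite /tens_class eqmodE; apply/asboolP.
Qed.

Lemma tens_repr_class s : tens_eq (tens_repr (tens_class s)) s.
Proof. by apply/tens_classP; rewrite tens_reprK. Qed.

Definition tens v w : tensor := tens_class [:: (v, w)].

Definition tens_zero : tensor := tens_class [::].
Definition tens_add (x y : tensor) : tensor :=
  tens_class (tens_repr x ++ tens_repr y).
Definition tens_scale a (x : tensor) : tensor :=
  tens_class [seq (a *: p.1, p.2) | p <- tens_repr x].
Definition tens_opp (x : tensor) : tensor := tens_scale (-1) x.

Lemma tens_ind_class (P : tensor -> Prop) :
  (forall s, P (tens_class s)) -> forall x, P x.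
Proof. by move=> Ps x; rewrite -(tens_reprK x). Qed.

Lemma tens_add_class s t :
  tens_add (tens_class s) (tens_class t) = tens_class (s ++ t).
Proof. by apply/tens_classP; apply: TensCat; exact: tens_repr_class. Qed.

Lemma tens_eq_scale a s t : tens_eq s t ->
  tens_eq [seq (a *: p.1, p.2) | p <- s] [seq (a *: p.1, p.2) | p <- t].
Proof.
elim=> {s t} /= [s|s t _ IH|s t u _ IH1 _ IH2|s1 t1 s2 t2 _ IH1 _ IH2|s t
                |v v' w|v w w'|b v w|].
- exact: TensRefl.
- exact: TensSym.
- exact: TensTrans IH1 IH2.
- by rewrite !map_cat; exact: TensCat.
- by rewrite !map_cat; exact: TensCatC.
- by rewrite scalerDr; exact: TensDl.
- exact: TensDr.
- by rewrite scalerA mulrC -scalerA; exact: TensZ.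
- by rewrite scaler0; exact: Tens0.
Qed.

Lemma tens_scale_class a s :
  tens_scale a (tens_class s) = tens_class [seq (a *: p.1, p.2) | p <- s].
Proof. by apply/tens_classP/tens_eq_scale; exact: tens_repr_class. Qed.

Lemma tens_addA : associative tens_add.
Proof.
elim/tens_ind_class=> s; elim/tens_ind_class=> t; elim/tens_ind_class=> u.
by rewrite !tens_add_class catA.
Qed.

Lemma tens_addC : commutative tens_add.
Proof.
elim/tens_ind_class=> s; elim/tens_ind_class=> t.
by rewrite !tens_add_class; apply/tens_classP; exact: TensCatC.
Qed.

Lemma tens_add0 : left_id tens_zero tens_add.
Proof. by elim/tens_ind_class=> s; rewrite tens_add_class. Qed.

Lemma tens_eq0l w : tens_eq [:: (0, w)] [::].
Proof.
have := TensZ 0 0 w; rewrite !scale0r => h.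
exact: TensTrans h Tens0.
Qed.

Lemma tens_scaleDl (x : tensor) (a b : K) :
  tens_scale (a + b) x = tens_add (tens_scale a x) (tens_scale b x).
Proof.
elim/tens_ind_class: x => s.
rewrite !tens_scale_class tens_add_class; apply/tens_classP.
elim: s => [|[v w] s IH] /=; first exact: TensRefl.
set sa := [seq (a *: p.1, p.2) | p <- s] in IH *.
set sb := [seq (b *: p.1, p.2) | p <- s] in IH *.
apply: (@TensTrans _ ([:: (a *: v, w); (b *: v, w)] ++ (sa ++ sb))).
  rewrite -[X in tens_eq X _]cat1s; apply: TensCat => //.
  by rewrite scalerDl; exact: TensDl.
rewrite -[X in tens_eq X _]/([:: (a *: v, w)] ++ ([:: (b *: v, w)] ++ sa ++ sb)).
rewrite -[X in tens_eq _ X]/([:: (a *: v, w)] ++ (sa ++ ([:: (b *: v, w)] ++ sb))).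
apply: TensCat; first exact: TensRefl.
rewrite !catA; apply: TensCat; last exact: TensRefl.
exact: TensCatC.
Qed.

Lemma tens_scale0 x : tens_scale 0 x = tens_zero.
Proof.
elim/tens_ind_class: x => s.
rewrite tens_scale_class; apply/tens_classP.
elim: s => [|[v w] s IH] /=; first exact: TensRefl.
rewrite scale0r -[X in tens_eq X _]cat1s -[X in tens_eq _ X]/([::] ++ [::]).
by apply: TensCat => //; exact: tens_eq0l.
Qed.

Lemma tens_scale1 : left_id 1 tens_scale.
Proof.
elim/tens_ind_class=> s; rewrite tens_scale_class; congr tens_class.
by elim: s => [//|[v w] s IH] /=; rewrite scale1r IH.
Qed.

Lemma tens_addN : left_inverse tens_zero tens_opp tens_add.
Proof.
move=> x; rewrite /tens_opp -{2}[x]tens_scale1 -tens_scaleDl.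
by rewrite addNr tens_scale0.
Qed.

HB.instance Definition _ := GRing.isZmodule.Build tensor
  tens_addA tens_addC tens_add0 tens_addN.

Lemma tens_scaleA a b x : tens_scale a (tens_scale b x) = tens_scale (a * b) x.
Proof.
elim/tens_ind_class: x => s; rewrite !tens_scale_class -map_comp.
by congr tens_class; apply: eq_map => p /=; rewrite scalerA.
Qed.

Lemma tens_scaleDr : right_distributive tens_scale +%R.
Proof.
move=> a; elim/tens_ind_class=> s; elim/tens_ind_class=> t.
by rewrite [_ + _]tens_add_class !tens_scale_class [RHS]tens_add_class map_cat.
Qed.

Lemma tens_scaleDl' x : {morph tens_scale^~ x : a b / a + b}.
Proof. by move=> a b; exact: tens_scaleDl. Qed.

HB.instance Definition _ := GRing.Zmodule_isLmodule.Build K tensor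
  tens_scaleA tens_scale1 tens_scaleDr tens_scaleDl'.

Lemma tensDl v v' w : tens (v + v') w = tens v w + tens v' w.
Proof. by rewrite [RHS]tens_add_class; apply/tens_classP; exact: TensDl. Qed.

Lemma tensDr v w w' : tens v (w + w') = tens v w + tens v w'.
Proof. by rewrite [RHS]tens_add_class; apply/tens_classP; exact: TensDr. Qed.

Lemma tensZl a v w : tens (a *: v) w = a *: tens v w.
Proof. by rewrite [RHS]tens_scale_class. Qed.

Lemma tensZr a v w : tens v (a *: w) = a *: tens v w.
Proof. by rewrite -tensZl; apply/tens_classP/TensSym; exact: TensZ. Qed.

Lemma tens_classE s : tens_class s = \sum_(p <- s) tens p.1 p.2.
Proof.
elim: s => [|[v w] s IH]; first by rewrite big_nil.
by rewrite big_cons -IH [RHS]tens_add_class.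
Qed.

Lemma tensE (x : tensor) : x = \sum_(p <- tens_repr x) tens p.1 p.2.
Proof. by rewrite -tens_classE tens_reprK. Qed.

Lemma tensor_ind (P : tensor -> Prop) :
  P 0 -> (forall x y, P x -> P y -> P (x + y)) -> (forall v w, P (tens v w)) ->
  forall x, P x.
Proof. by move=> P0 PD Pt x; rewrite (tensE x); elim/big_ind: _. Qed.

Lemma tens_bilinear : bilinear_for *:%R *:%R tens.
Proof.
split=> [w a v v'|v a w w']; first by rewrite tensDl tensZl.
by rewrite tensDr tensZr.
Qed.

(* For bilinear b, tlift b is the linear map v \ox w |-> b v w (tlift_tens, *)
(* tlift_linear); it carries no meaning when b is not bilinear.             *)
Definition tlift (U : lmodType K) (b : V -> W -> U) (x : tensor) : U :=
  \sum_(p <- tens_repr x) b p.1 p.2.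

Section Lift.
Variables (U : lmodType K) (b : V -> W -> U).
Hypothesis b_bilin : bilinear_for *:%R *:%R b.

Let bDl v v' w : b (v + v') w = b v w + b v' w.
Proof. by have := b_bilin.1 w 1 v v'; rewrite /= !scale1r. Qed.
Let bDr v w w' : b v (w + w') = b v w + b v w'.
Proof. by have := b_bilin.2 v 1 w w'; rewrite /= !scale1r. Qed.
Let b00 : b 0 0 = 0.
Proof. by apply: (addIr (b 0 0)); rewrite -bDl !add0r. Qed.
Let b0r v : b v 0 = 0.
Proof. by apply: (addIr (b v 0)); rewrite -bDr !add0r. Qed.
Let b0l w : b 0 w = 0.
Proof. by apply: (addIr (b 0 w)); rewrite -bDl !add0r. Qed.
Let bZl a v w : b (a *: v) w = a *: b v w.
Proof. by have := b_bilin.1 w a v 0; rewrite /= !addr0 b0l addr0. Qed.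
Let bZr a v w : b v (a *: w) = a *: b v w.
Proof. by have := b_bilin.2 v a w 0; rewrite /= !addr0 b0r addr0. Qed.

Lemma tens_eq_lift s t : tens_eq s t ->
  \sum_(p <- s) b p.1 p.2 = \sum_(p <- t) b p.1 p.2.
Proof.
elim=> {s t} //= [s t u _ -> _ ->|s1 t1 s2 t2 _ e1 _ e2|s t
                |v v' w|v w w'|a v w|] //.
- by rewrite !big_cat /= e1 e2.
- by rewrite !big_cat /= addrC.
- by rewrite !big_cons !big_nil /= !addr0 bDl.
- by rewrite !big_cons !big_nil /= !addr0 bDr.
- by rewrite !big_cons !big_nil /= bZl bZr.
- by rewrite !big_cons !big_nil /= b00 addr0.
Qed.

Lemma tlift_class s : tlift b (tens_class s) = \sum_(p <- s) b p.1 p.2.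
Proof. by apply: tens_eq_lift; exact: tens_repr_class. Qed.

Lemma tlift_tens v w : tlift b (tens v w) = b v w.
Proof. by rewrite tlift_class big_seq1. Qed.

Lemma tlift_linear : linear (tlift b).
Proof.
move=> a; elim/tens_ind_class=> s; elim/tens_ind_class=> t.
rewrite [_ *: _]tens_scale_class [_ + _]tens_add_class !tlift_class.
rewrite big_cat big_map scaler_sumr; congr (_ + _).
by apply: eq_bigr => p _; rewrite /= bZl.
Qed.

End Lift.
End TensorModule.

Notation "v \ox w" := (tens v w) (at level 40, left associativity) : ring_scope.

Section TensorMaps.
Variable K : fieldType.

Definition tmap (V V' W W' : lmodType K) (f : V -> V') (g : W -> W') :
    tensor V W -> tensor V' W' :=
  tlift (fun v w => f v \ox g w).

Definition tassoc (U V W : lmodType K) :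
    tensor (tensor U V) W -> tensor U (tensor V W) :=
  tlift (fun x w => tlift (fun u v => u \ox (v \ox w)) x).

Definition tswap (V W : lmodType K) : tensor V W -> tensor W V :=
  tlift (fun v w => w \ox v).

End TensorMaps.

(* A nonzero vector of a K-vector space is detected by a linear functional; *)
(* used to see that the tensor product of nonzero algebras is nonzero.      *)
Section Functional.
Variables (K : fieldType) (V : lmodType K) (e : V).
Hypothesis e_neq0 : e != 0.

Let pfun (G : set (V * K)) : Prop :=
  [/\ forall a x y, G x -> G y -> G (a *: x.1 + y.1, a * x.2 + y.2),
      (forall c, G (0, c) -> c = 0) & G !=set0].

Let pfun' (G : set (V * K)) : Prop :=
  G = set0 \/ (pfun G /\ G (e, 1)).

Lemma linear_functional_ex : exists f : V -> K^o, linear f /\ f e = 1.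
Proof.
have [|G [PG Gmax]] := @Zorn_bigcup _ pfun'.
  move=> F FP Ftot.
  have [[A [FA An0]]|noA] := pselect (exists A, F A /\ A !=set0); last first.
    left; rewrite -subset0 => x [A FA Ax].
    by apply: noA; exists A; split => //; exists x.
  right.
  have big B : F B -> B !=set0 -> pfun B /\ B (e, 1).
    by move=> FB [x Bx]; case: (FP _ FB) => // B0; rewrite B0 in Bx.
  split; last by exists A => //; case: (big _ FA An0).
  split; last by case: An0 => x Ax; exists x, A.
  - move=> a x y [B FB Bx] [C FC Cy].
    have BB : pfun B by case: (big B FB) => //; exists x.
    have CC : pfun C by case: (big C FC) => //; exists y.
    case: (Ftot _ _ FB FC) => le.
    + by exists C => //; case: CC => h _ _; apply: h => //; exact: le.
    + by exists B => //; case: BB => h _ _; apply: h => //; exact: le.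
  - move=> c [B FB Bc].
    have BB : pfun B by case: (big B FB) => //; exists (0, c).
    by case: BB => _ h _; exact: h.
pose L : set (V * K) := [set p | p.1 = p.2 *: e].
have pL : pfun' L.
  right; split; last by rewrite /L /= scale1r.
  split; last by exists (e, 1); rewrite /L /= scale1r.
  - by move=> a x y; rewrite /L /= => -> ->; rewrite scalerA scalerDl.
  - move=> c; rewrite /L /= => /esym/eqP; rewrite scaler_eq0 (negPf e_neq0).
    by rewrite orbF => /eqP.
case: PG => [G0|[[Glin Gfun Gne] Ge]].
  exfalso; apply: (Gmax L) => //; rewrite G0; split => // L0.
  by have := L0 (e, 1); apply; rewrite /L /= scale1r.
have G00 : G (0, 0).
  case: Gne => x Gx; have := Glin (-1) x x Gx Gx.
  by rewrite scaleN1r addNr mulN1r addNr.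
have Gtot v : exists c, G (v, c).
  apply: contrapT => nv.
  pose G' : set (V * K) :=
    [set p | exists q a, G q /\ p = (a *: v + q.1, q.2)].
  apply: (Gmax G').
    split; first by move=> [x c] Gx; exists (x, c), 0; rewrite scale0r add0r.
    move=> le; apply: nv; exists 0; apply: le; exists (0, 0), 1.
    by rewrite scale1r addr0.
  right; split; last by exists (e, 1), 0; rewrite scale0r add0r.
  split; last by exists (e, 1), (e, 1), 0; rewrite scale0r add0r.
  - move=> a x y [q [b [Gq ->]]] [r [c [Gr ->]]] /=.
    exists (a *: q.1 + r.1, a * q.2 + r.2), (a * b + c).
    split; first exact: Glin.
    by rewrite /= scalerDr scalerA scalerDl addrACA.
  - move=> c [q [a [Gq [h ->]]]].
    have [a0|a0] := eqVneq a 0.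
      apply: Gfun; move: h; rewrite a0 scale0r add0r => ->.
      by case: q Gq.
    exfalso; apply: nv; exists (- a^-1 * q.2).
    have := Glin (- a^-1) q (0, 0) Gq G00; rewrite /= !addr0.
    suff -> : - a^-1 *: q.1 = v by [].
    have -> : q.1 = - (a *: v) by apply/eqP; rewrite -addr_eq0 addrC -h.
    by rewrite scaleNr scalerN opprK scalerA mulVf // scale1r.
pose f v := sval (cid (Gtot v)).
have fP v : G (v, f v) by rewrite /f; case: cid.
have fU v c : G (v, c) -> f v = c.
  move=> Gc; have := Glin (-1) _ _ Gc (fP v).
  rewrite /= scaleN1r addNr mulN1r addrC => /Gfun/eqP.
  by rewrite subr_eq0 => /eqP.
exists f; split; last exact: fU.
by move=> a x y; apply: fU; exact: (Glin a (x, f x) (y, f y)).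
Qed.

End Functional.

Section TensorAlgebra.
Variables (K : fieldType) (A B : comAlgType K).

Definition tens_one : tensor A B := 1 \ox 1.
Definition tens_mul (x y : tensor A B) : tensor A B :=
  tlift (fun a b => tlift (fun a' b' => (a * a') \ox (b * b')) y) x.

Lemma tens_mul_bilin a b :
  bilinear_for *:%R *:%R (fun (a' : A) (b' : B) => (a * a') \ox (b * b')).
Proof.
split=> [b' c a1 a2|a' c b1 b2] /=.
  by rewrite mulrDr -scalerAr tensDl tensZl.
by rewrite mulrDr -scalerAr tensDr tensZr.
Qed.

Lemma tens_mul_tensl a b (y : tensor A B) :
  tens_mul (a \ox b) y = tlift (fun a' b' => (a * a') \ox (b * b')) y.
Proof.
have tl0 a0 b0 : tlift (fun a' b' => (a0 * a') \ox (b0 * b')) (0 : tensor A B) = 0.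
  have := tlift_linear (tens_mul_bilin a0 b0) (-1) 0 0.
  by rewrite scaleN1r addNr scaleN1r addNr.
have tlD a0 b0 (x x' : tensor A B) :
    tlift (fun a' b' => (a0 * a') \ox (b0 * b')) (x + x') =
    tlift (fun a' b' => (a0 * a') \ox (b0 * b')) x +
    tlift (fun a' b' => (a0 * a') \ox (b0 * b')) x'.
  by have := tlift_linear (tens_mul_bilin a0 b0) 1 x x'; rewrite !scale1r.
rewrite /tens_mul tlift_tens //; split=> [b0 c a1 a2|a0 c b1 b2] /=.
  elim/tensor_ind: y => [|x x' IH IH'|a' b'].
  - by rewrite !tl0 scaler0 addr0.
  - by rewrite !tlD IH IH' scalerDr addrACA.
  - rewrite !(tlift_tens (tens_mul_bilin _ _)) mulrDl -scalerAl.
    by rewrite tensDl tensZl.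
elim/tensor_ind: y => [|x x' IH IH'|a' b'].
- by rewrite !tl0 scaler0 addr0.
- by rewrite !tlD IH IH' scalerDr addrACA.
- rewrite !(tlift_tens (tens_mul_bilin _ _)) mulrDl -scalerAl.
  by rewrite tensDr tensZr.
Qed.

Lemma tens_mulE a b a' b' :
  tens_mul (a \ox b) (a' \ox b') = (a * a') \ox (b * b').
Proof. by rewrite tens_mul_tensl tlift_tens //; exact: tens_mul_bilin. Qed.

Lemma tens_mulDr : right_distributive tens_mul +%R.
Proof.
move=> x y z; rewrite /tens_mul /tlift -big_split /=; apply: eq_bigr => p _.
have := tlift_linear (tens_mul_bilin p.1 p.2) 1 y z.
by rewrite !scale1r.
Qed.

Lemma tens_mul_tensC a b (y : tensor A B) :
  tens_mul (a \ox b) y = tens_mul y (a \ox b).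
Proof.
rewrite tens_mul_tensl; apply: eq_bigr => p _.
by rewrite tlift_tens; [rewrite mulrC (mulrC b)|exact: tens_mul_bilin].
Qed.

Lemma tens_mul0r x : tens_mul x 0 = 0.
Proof. by apply: (addIr (tens_mul x 0)); rewrite -tens_mulDr !add0r. Qed.

Lemma tens_mulC : commutative tens_mul.
Proof.
have h0 y : tens_mul 0 y = 0.
  elim/tensor_ind: y => [|x y IHx IHy|a b]; first exact: tens_mul0r.
    by rewrite tens_mulDr IHx IHy addr0.
  by rewrite -tens_mul_tensC tens_mul0r.
move=> + y; elim/tensor_ind: y => [x|y z IHy IHz x|a b x].
- by rewrite h0 tens_mul0r.
- rewrite tens_mulDr IHy IHz.
  elim/tensor_ind: x => [|x x' IHx IHx'|a b]; first by rewrite !tens_mul0r addr0.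
    by rewrite !tens_mulDr addrACA IHx IHx'.
  by rewrite -!tens_mul_tensC -tens_mulDr.
- by rewrite tens_mul_tensC.
Qed.

Lemma tens_mulDl : left_distributive tens_mul +%R.
Proof. by move=> x y z; rewrite tens_mulC tens_mulDr !(tens_mulC z). Qed.

Lemma tens_mul0l y : tens_mul 0 y = 0.
Proof. by rewrite tens_mulC tens_mul0r. Qed.

Lemma tens_mulA : associative tens_mul.
Proof.
move=> x y z; elim/tensor_ind: x => [|x x' IH IH'|a b].
- by rewrite !tens_mul0l.
- by rewrite !tens_mulDl IH IH'.
elim/tensor_ind: y => [|y y' IH IH'|a' b'].
- by rewrite tens_mul0l !tens_mul0r tens_mul0l.
- by rewrite tens_mulDl !tens_mulDr IH IH' tens_mulDl.
elim/tensor_ind: z => [|z z' IH IH'|a'' b''].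
- by rewrite !tens_mul0r.
- by rewrite !tens_mulDr IH IH'.
- by rewrite !tens_mulE !mulrA.
Qed.

Lemma tens_mul1 : left_id tens_one tens_mul.
Proof.
elim/tensor_ind=> [|x x' IH IH'|a b]; first by rewrite tens_mul0r.
  by rewrite tens_mulDr IH IH'.
by rewrite tens_mulE !mul1r.
Qed.

Lemma tens_one_neq0 : tens_one != 0.
Proof.
have [f [flin f1]] := linear_functional_ex (oner_neq0 A).
have [g [glin g1]] := linear_functional_ex (oner_neq0 B).
pose b (x : A) (y : B) : K^o := f x * g y.
have bb : bilinear_for *:%R *:%R b.
  split=> [y c x x'|x c y y'] /=; rewrite /b.
    by rewrite flin mulrDl -scalerAl.
  by rewrite glin mulrDr -scalerAr.
apply/eqP => h; have := tlift_tens bb 1 1; rewrite -/tens_one h.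
have -> : tlift b 0 = 0.
  have := tlift_linear bb (-1) 0 0.
  by rewrite scaleN1r addNr scaleN1r addNr.
by rewrite /b f1 g1 mulr1 => /esym/eqP; rewrite oner_eq0.
Qed.

HB.instance Definition _ := GRing.Zmodule_isComNzRing.Build (tensor A B)
  tens_mulA tens_mulC tens_mul1 tens_mulDl tens_one_neq0.

Lemma tens_scalerAl (c : K) (x y : tensor A B) : c *: (x * y) = (c *: x) * y.
Proof.
elim/tensor_ind: x => [|x x' IH IH'|a b].
- by rewrite scaler0 mul0r scaler0.
- by rewrite mulrDl !scalerDr mulrDl IH IH'.
elim/tensor_ind: y => [|y y' IH IH'|a' b'].
- by rewrite !mulr0 scaler0.
- by rewrite !mulrDr scalerDr IH IH'.
- by rewrite -tensZl [_ * _]tens_mulE [RHS]tens_mulE -tensZl scalerAl.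
Qed.

HB.instance Definition _ := GRing.Lmodule_isLalgebra.Build K (tensor A B)
  tens_scalerAl.
HB.instance Definition _ := GRing.Lalgebra_isComAlgebra.Build K (tensor A B).

Lemma tensM (a a' : A) (b b' : B) :
  (a \ox b) * (a' \ox b') = (a * a') \ox (b * b').
Proof. exact: tens_mulE. Qed.

End TensorAlgebra.


Section DirectLimit.
Variables (K : fieldType) (A : nat -> comAlgType K).
Variable j : forall n, {lrmorphism A n -> A n.+1}.

(* The transition map A n -> A m; only meaningful for n <= m.               *)
Fixpoint up n m (x : A n) {struct m} : A m :=
  match n =P m with
  | ReflectT e => ecast i (A i) e x
  | ReflectF _ => match m return A m with
                  | 0 => 0
                  | m'.+1 => j m' (up m' x)
                  end
  end.

Lemma up_id n (x : A n) : up n x = x.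
Proof. by case: n x => [|n] x /=; case: eqP => // e; rewrite eq_axiomK. Qed.

Lemma upS n m (x : A n) : (n <= m)%N -> up m.+1 x = j m (up m x).
Proof. by move=> nm /=; case: eqP => // e; exfalso; move: nm; rewrite e ltnn. Qed.

Lemma up_up n m p (x : A n) : (n <= m)%N -> (m <= p)%N -> up p (up m x) = up p x.
Proof.
move=> nm; elim: p => [|p IH].
  by rewrite leqn0 => /eqP m0; subst m; rewrite up_id.
rewrite leq_eqVlt => /predU1P[e|mp]; first by subst m; rewrite up_id.
by rewrite !upS ?IH //; exact: leq_trans nm mp.
Qed.

Lemma up_linear n m : (n <= m)%N -> linear (@up n m).
Proof.
elim: m => [|m IH].
  by rewrite leqn0 => /eqP n0 a x y; subst n; rewrite !up_id.
rewrite leq_eqVlt => /predU1P[e|nm] a x y; first by subst n; rewrite !up_id.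
by rewrite !upS // IH // linearP.
Qed.

Lemma up_monoid_morphism n m : (n <= m)%N -> monoid_morphism (@up n m).
Proof.
elim: m => [|m IH].
  by rewrite leqn0 => /eqP n0; subst n; split=> [|x y]; rewrite !up_id.
rewrite leq_eqVlt => /predU1P[e|nm].
  by subst n; split=> [|x y]; rewrite !up_id.
by split=> [|x y]; rewrite !upS // IH // (rmorph1, rmorphM).
Qed.

Definition dl_pre := {n : nat & A n}.
Definition dl_eq (p q : dl_pre) : Prop := exists N,
  [/\ (tag p <= N)%N, (tag q <= N)%N & up N (tagged p) = up N (tagged q)].
Definition dl_eqb : rel dl_pre := fun p q => `[< dl_eq p q >].

Lemma dl_eqb_refl : reflexive dl_eqb.
Proof. by move=> p; apply/asboolP; exists (tag p). Qed.
Lemma dl_eqb_sym : symmetric dl_eqb.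
Proof. by move=> p q; apply/asboolP/asboolP => -[N [? ? ?]]; exists N. Qed.
Lemma dl_eqb_trans : transitive dl_eqb.
Proof.
move=> q p r /asboolP[N [pN qN e]] /asboolP[M [qM rM e']].
apply/asboolP; exists (maxn N M); split.
- by rewrite leq_max pN.
- by rewrite leq_max rM orbT.
- rewrite -(@up_up _ N) ?leq_maxl // e up_up ?leq_maxl //.
  by rewrite -(@up_up _ M) ?leq_maxr // e' up_up ?leq_maxr.
Qed.

Canonical dl_equiv := EquivRel dl_eqb dl_eqb_refl dl_eqb_sym dl_eqb_trans.

Definition dlim : Type := {eq_quot dl_equiv}%qT.
HB.instance Definition _ := Choice.on dlim.

Definition dl_in n (x : A n) : dlim :=
  (\pi_({eq_quot dl_equiv}) (Tagged (fun i => A i) x))%qT.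
Definition dl_level (x : dlim) : nat := tag (@repr _ {eq_quot dl_equiv}%qT x).
Definition dl_repr (x : dlim) : A (dl_level x) :=
  tagged (@repr _ {eq_quot dl_equiv}%qT x).

Lemma dl_reprK x : dl_in (dl_repr x) = x.
Proof.
rewrite /dl_in /dl_repr /dl_level -[RHS](@reprK _ {eq_quot dl_equiv}%qT).
by case: (repr x).
Qed.

Lemma dl_inP n m (x : A n) (y : A m) : dl_in x = dl_in y <->
  exists N, [/\ (n <= N)%N, (m <= N)%N & up N x = up N y].
Proof.
split; first by move=> /eqP; rewrite /dl_in eqmodE => /asboolP.
by move=> h; apply/eqP; rewrite /dl_in eqmodE; apply/asboolP.
Qed.

Lemma dl_in_up n m (x : A n) : (n <= m)%N -> dl_in (up m x) = dl_in x.
Proof. by move=> nm; apply/dl_inP; exists m; rewrite up_id. Qed.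

Lemma dl_in_le (x : dlim) : exists n, forall N, (n <= N)%N ->
  exists a : A N, x = dl_in a.
Proof.
exists (dl_level x) => N le; exists (up N (dl_repr x)).
by rewrite dl_in_up // dl_reprK.
Qed.

Lemma dl_common3 (x y z : dlim) : exists N (a b c : A N),
  [/\ x = dl_in a, y = dl_in b & z = dl_in c].
Proof.
have [n hn] := dl_in_le x; have [m hm] := dl_in_le y.
have [p hp] := dl_in_le z.
set N := maxn n (maxn m p).
have [a ->] : exists a : A N, x = dl_in a by apply: hn; rewrite leq_maxl.
have [b ->] : exists b : A N, y = dl_in b.
  by apply: hm; rewrite !leq_max leqnn orbT.
have [c ->] : exists c : A N, z = dl_in c.
  by apply: hp; rewrite !leq_max leqnn !orbT.
by exists N, a, b, c.
Qed.

Definition dl_op2 (op : forall n, A n -> A n -> A n) (x y : dlim) : dlim :=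
  let N := maxn (dl_level x) (dl_level y) in
  dl_in (op N (up N (dl_repr x)) (up N (dl_repr y))).
Definition dl_zero : dlim := dl_in (0 : A 0).
Definition dl_one : dlim := dl_in (1 : A 0).
Definition dl_add := dl_op2 (fun n => +%R).
Definition dl_mul := dl_op2 (fun n => *%R).
Definition dl_scale (a : K) (x : dlim) : dlim := dl_in (a *: dl_repr x).
Definition dl_opp (x : dlim) : dlim := dl_scale (-1) x.

Lemma dl_op2E (op : forall n, A n -> A n -> A n) n (x y : A n) :
  (forall p q (a b : A p), (p <= q)%N ->
     up q (op p a b) = op q (up q a) (up q b)) ->
  dl_op2 op (dl_in x) (dl_in y) = dl_in (op n x y).
Proof.
move=> opu; rewrite /dl_op2; apply/dl_inP; set N := maxn _ _.
have [M [le1 le2 e]] := (dl_inP _ _).1 (dl_reprK (dl_in x)).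
have [M' [le1' le2' e']] := (dl_inP _ _).1 (dl_reprK (dl_in y)).
exists (maxn M M'); split.
- by rewrite geq_max !leq_max le1 le1' orbT.
- by rewrite leq_max le2.
rewrite !opu ?geq_max ?leq_max ?le1 ?le1' ?le2 ?orbT //.
rewrite !up_up ?leq_maxl ?leq_maxr ?geq_max ?leq_max ?le1 ?le1' ?orbT //.
congr op.
  by rewrite -(@up_up _ M) ?leq_maxl // e up_up // leq_maxl.
by rewrite -(@up_up _ M') ?leq_maxr // e' up_up // leq_maxr.
Qed.

Lemma dl_addE n (x y : A n) : dl_add (dl_in x) (dl_in y) = dl_in (x + y).
Proof.
apply: (@dl_op2E (fun n => +%R)) => p q a b pq.
by have := up_linear pq 1 a b; rewrite !scale1r.
Qed.

Lemma dl_mulE n (x y : A n) : dl_mul (dl_in x) (dl_in y) = dl_in (x * y).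
Proof.
apply: (@dl_op2E (fun n => *%R)) => p q a b pq.
by rewrite (up_monoid_morphism pq).2.
Qed.

Lemma up0 n m : (n <= m)%N -> up m (0 : A n) = 0.
Proof.
by move=> nm; have := up_linear nm (-1) 0 0; rewrite !scaleN1r !addNr.
Qed.

Lemma upZ n m a (x : A n) : (n <= m)%N -> up m (a *: x) = a *: up m x.
Proof. by move=> nm; have := up_linear nm a x 0; rewrite up0 // !addr0. Qed.

Lemma dl_scaleE a n (x : A n) : dl_scale a (dl_in x) = dl_in (a *: x).
Proof.
apply/dl_inP; have [M [le1 le2 e]] := (dl_inP _ _).1 (dl_reprK (dl_in x)).
by exists M; split=> //; rewrite !upZ // e.
Qed.

Lemma dl_zeroE n : dl_zero = dl_in (0 : A n).
Proof. by apply/dl_inP; exists n; rewrite up_id up0. Qed.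

Lemma dl_oneE n : dl_one = dl_in (1 : A n).
Proof.
by apply/dl_inP; exists n; rewrite up_id (up_monoid_morphism (leq0n n)).1.
Qed.

Lemma dl_addA : associative dl_add.
Proof.
move=> x y z; have [N [a [b [c [-> -> ->]]]]] := dl_common3 x y z.
by rewrite !dl_addE addrA.
Qed.

Lemma dl_addC : commutative dl_add.
Proof.
move=> x y; have [N [a [b [_ [-> -> _]]]]] := dl_common3 x y y.
by rewrite !dl_addE addrC.
Qed.

Lemma dl_add0 : left_id dl_zero dl_add.
Proof. by move=> x; rewrite -(dl_reprK x) (dl_zeroE (dl_level x)) dl_addE add0r. Qed.

Lemma dl_addN : left_inverse dl_zero dl_opp dl_add.
Proof.
move=> x; rewrite -(dl_reprK x) (dl_zeroE (dl_level x)) /dl_opp dl_scaleE.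
by rewrite dl_addE scaleN1r addNr.
Qed.

HB.instance Definition _ := GRing.isZmodule.Build dlim
  dl_addA dl_addC dl_add0 dl_addN.

Lemma dl_mulA : associative dl_mul.
Proof.
move=> x y z; have [N [a [b [c [-> -> ->]]]]] := dl_common3 x y z.
by rewrite !dl_mulE mulrA.
Qed.

Lemma dl_mulC : commutative dl_mul.
Proof.
move=> x y; have [N [a [b [_ [-> -> _]]]]] := dl_common3 x y y.
by rewrite !dl_mulE mulrC.
Qed.

Lemma dl_mul1 : left_id dl_one dl_mul.
Proof. by move=> x; rewrite -(dl_reprK x) (dl_oneE (dl_level x)) dl_mulE mul1r. Qed.

Lemma dl_mulDl : left_distributive dl_mul +%R.
Proof.
move=> x y z; have [N [a [b [c [-> -> ->]]]]] := dl_common3 x y z.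
by rewrite [_ + _]dl_addE !dl_mulE [RHS]dl_addE mulrDl.
Qed.

Lemma dl_one_neq0 : dl_one != 0.
Proof.
apply/eqP => /dl_inP[N [_ _]]; rewrite up0 // (up_monoid_morphism _).1 //.
by apply/eqP; exact: oner_neq0.
Qed.

HB.instance Definition _ := GRing.Zmodule_isComNzRing.Build dlim
  dl_mulA dl_mulC dl_mul1 dl_mulDl dl_one_neq0.

Lemma dl_scaleA a b x : dl_scale a (dl_scale b x) = dl_scale (a * b) x.
Proof. by rewrite -(dl_reprK x) !dl_scaleE scalerA. Qed.

Lemma dl_scale1 : left_id 1 dl_scale.
Proof. by move=> x; rewrite -(dl_reprK x) dl_scaleE scale1r. Qed.

Lemma dl_scaleDr : right_distributive dl_scale +%R.
Proof.
move=> a x y; have [N [b [c [_ [-> -> _]]]]] := dl_common3 x y y.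
by rewrite [_ + _]dl_addE !dl_scaleE [RHS]dl_addE scalerDr.
Qed.

Lemma dl_scaleDl x : {morph dl_scale^~ x : a b / a + b}.
Proof.
by move=> a b; rewrite -(dl_reprK x) !dl_scaleE [RHS]dl_addE scalerDl.
Qed.

HB.instance Definition _ := GRing.Zmodule_isLmodule.Build K dlim
  dl_scaleA dl_scale1 dl_scaleDr dl_scaleDl.

Lemma dl_scalerAl (a : K) (x y : dlim) : a *: (x * y) = (a *: x) * y.
Proof.
have [N [b [c [_ [-> -> _]]]]] := dl_common3 x y y.
rewrite -[dl_in b * dl_in c]/(dl_mul _ _) dl_mulE.
rewrite -[LHS]/(dl_scale _ _) dl_scaleE -[a *: dl_in b]/(dl_scale _ _) dl_scaleE.
by rewrite -[RHS]/(dl_mul _ _) dl_mulE scalerAl.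
Qed.

HB.instance Definition _ := GRing.Lmodule_isLalgebra.Build K dlim dl_scalerAl.
HB.instance Definition _ := GRing.Lalgebra_isComAlgebra.Build K dlim.

Lemma dl_in_linear n : linear (@dl_in n).
Proof. by move=> a x y; rewrite -dl_addE -dl_scaleE. Qed.

Lemma dl_in_monoid_morphism n : monoid_morphism (@dl_in n).
Proof. by split=> [|x y]; rewrite -?dl_oneE -?dl_mulE. Qed.

End DirectLimit.

(* Rows and columns are numbered from 0: the matrix unit e_{ij} on paper has *)
(* its entry at position (i-1, j-1) here.  The same shift applies to tensor  *)
(* factors and to the operators of a Rota-Baxter hierarchy.                  *)

Section InfiniteMatrices.
Variable K : fieldType.

Definition almost_id (f : nat -> nat -> K) : Prop := exists n, forall i j,
  (n <= i)%N \/ (n <= j)%N -> f i j = (i == j)%:R.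

Record imatrix := IMatrix {
  imx_fun :> nat -> nat -> K;
  imxP : almost_id imx_fun
}.

Implicit Types M N : imatrix.

Lemma imatrix_eq M N : (forall i j, M i j = N i j) -> M = N.
Proof.
case: M N => [f fP] [g gP] /= e; have {}e : f = g.
  by apply/funext => i; apply/funext => j.
by subst g; congr IMatrix; exact: Prop_irrelevance.
Qed.

Definition imx_bound M : nat := sval (cid (imxP M)).

Lemma imx_boundP M i j : (imx_bound M <= i)%N \/ (imx_bound M <= j)%N ->
  M i j = (i == j)%:R.
Proof. by rewrite /imx_bound; case: cid => n /= h; exact: h. Qed.

Lemma imx1_proof : almost_id (fun i j => (i == j)%:R).
Proof. by exists 0. Qed.
Definition imx1 := IMatrix imx1_proof.

Lemma imx_mul_sumE M (f : nat -> K) n i : (imx_bound M <= n)%N -> (i < n)%N ->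
  \sum_(k \in [set: nat]) M i k * f k = \sum_(k < n) M i k * f k.
Proof.
move=> Mn ltin; rewrite (fsbig_ord _ n (fun k => M i k * f k)).
apply/esym/fsbig_widen => // k [_ /= /negP]; rewrite -leqNgt => nk.
rewrite imx_boundP; last by right; exact: leq_trans nk.
by rewrite ltn_eqF ?mul0r //; exact: leq_trans nk.
Qed.

Lemma imx_mul_proof M N :
  almost_id (fun i j => \sum_(k \in [set: nat]) M i k * N k j).
Proof.
set b := maxn (imx_bound M) (imx_bound N).
have [bM bN] : (imx_bound M <= b)%N /\ (imx_bound N <= b)%N.
  by rewrite leq_maxl leq_maxr.
exists b => i j ij.
set n := (maxn b i).+1.
have ni : (i < n)%N by rewrite ltnS leq_maxr.
have nb : (b <= n)%N by rewrite leqW // leq_maxl.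
rewrite (@imx_mul_sumE _ _ n) //; last exact: leq_trans nb.
have [ib|ib] := leqP b i.
  rewrite (bigD1 (Ordinal ni)) //= big1 ?addr0 => [|k ki].
    rewrite imx_boundP ?eqxx ?mul1r; last by left; exact: leq_trans ib.
    by rewrite imx_boundP //; left; exact: leq_trans ib.
  rewrite imx_boundP; last by left; exact: leq_trans ib.
  by rewrite eq_sym -[i]/(val (Ordinal ni)) val_eqE (negPf ki) mul0r.
have {}ij : (b <= j)%N by case: ij => //; rewrite leqNgt ib.
have ji : (i == j) = false by apply/negbTE; rewrite neq_ltn (leq_trans ib ij).
rewrite ji big1 // => k _; rewrite [N k j]imx_boundP; last first.
  by right; exact: leq_trans ij.
have [kj|_] := eqVneq (k : nat) j; last by rewrite mulr0.
rewrite kj imx_boundP ?ji ?mul0r //.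
by right; exact: leq_trans ij.
Qed.
Definition imx_mul M N := IMatrix (imx_mul_proof M N).


(* The identification of M with diag(M, I), for M an n x n matrix.          *)
Definition imx_mx_fun n (M : 'M[K]_n) (i j : nat) : K :=
  match (insub i : option 'I_n), (insub j : option 'I_n) with
  | Some i', Some j' => M i' j'
  | _, _ => (i == j)%:R
  end.
Lemma imx_mx_proof n (M : 'M[K]_n) : almost_id (imx_mx_fun M).
Proof.
exists n => i j; rewrite /imx_mx_fun.
by case: insubP => // i' ltin _; case: insubP => // j' ltjn _;
   case; rewrite leqNgt ?ltin ?ltjn.
Qed.
Definition imx_mx n (M : 'M[K]_n) := IMatrix (imx_mx_proof M).

(* diag(I_m, M) *)
Lemma imx_shift_proof m M : almost_id (fun i j =>
  if (m <= i)%N && (m <= j)%N then M (i - m)%N (j - m)%N else (i == j)%:R).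
Proof.
exists (m + imx_bound M)%N => i j ij; case: ifP => // /andP[mi mj].
rewrite imx_boundP; last by case: ij => h; [left|right]; rewrite leq_subRL.
by rewrite -(eqn_add2r m) !subnK.
Qed.
Definition imx_shift m M := IMatrix (imx_shift_proof m M).

(* The first n rows of M, completed by rows of the identity matrix.         *)
Lemma imx_trunc_proof n M :
  almost_id (fun i j => if (i < n)%N then M i j else (i == j)%:R).
Proof. by exists (imx_bound M) => i j ij; case: ifP => // _; exact: imx_boundP. Qed.
Definition imx_trunc n M := IMatrix (imx_trunc_proof n M).

(* I - e_{kk}; with 1-based numbering this is E_{k+1}.                      *)
Lemma imx_E_proof k : almost_id (fun i j => ((i == j) && (i != k))%:R).
Proof.
exists k.+1 => i j ij; case: eqP => //= ej; subst j.
by case: eqP => // ik; subst i; case: ij; rewrite ltnn.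
Qed.
Definition imx_E k := IMatrix (imx_E_proof k).

(* diag(c, 1, 1, ...) *)
Lemma imx_scal_proof c : almost_id (fun i j =>
  if (i == 0%N) && (j == 0%N) then c else (i == j)%:R).
Proof. by exists 1%N => -[|i] [|j] //= [] . Qed.
Definition imx_scal c := IMatrix (imx_scal_proof c).

(* T_1(e_1) = I + e_{12} in 1-based numbering *)
Lemma imx_T1_proof : almost_id (fun i j =>
  (i == j)%:R + ((i == 0%N) && (j == 1%N))%:R).
Proof. by exists 2%N => -[|[|i]] [|[|j]] //= []; rewrite ?addr0. Qed.
Definition imx_T1 := IMatrix imx_T1_proof.

(* imx_L i w is L_{i+1}(w): the vector w is added to column i, starting just *)
(* below the diagonal.                                                       *)
Lemma imx_L_proof i m (w : 'cV[K]_m) : almost_id (fun k j =>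
  (k == j)%:R + \sum_(p < m) w p 0 * ((k == i.+1 + p)%N && (j == i))%:R).
Proof.
exists (i.+1 + m)%N => k j kj; rewrite big1 ?addr0 // => p _.
case: (_ =P _) => //= [kp|]; last by rewrite mulr0.
case: (_ =P _) => //= [ji|]; last by rewrite mulr0.
exfalso; case: kj; first by rewrite kp leq_add2l leqNgt ltn_ord.
by rewrite ji addSn ltnNge leq_addr.
Qed.
Definition imx_L i m (w : 'cV[K]_m) := IMatrix (imx_L_proof i w).

Lemma imx_swap_proof p q : almost_id (fun i j =>
  (j == (if i == p then q else if i == q then p else i))%:R).
Proof.
exists (maxn p q).+1 => i j ij; congr (_%:R); congr nat_of_bool.
have [ip|_] := eqVneq i p.
  subst i; case: ij; first by rewrite ltnNge leq_maxl.
  move=> h; rewrite [LHS]gtn_eqF; last by apply: leq_trans h; rewrite ltnS leq_maxr.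
  by rewrite ltn_eqF //; apply: leq_trans h; rewrite ltnS leq_maxl.
have [iq|_] := eqVneq i q; last by rewrite eq_sym.
subst i; case: ij; first by rewrite ltnNge leq_maxr.
move=> h; rewrite [LHS]gtn_eqF; last by apply: leq_trans h; rewrite ltnS leq_maxl.
by rewrite ltn_eqF //; apply: leq_trans h; rewrite ltnS leq_maxr.
Qed.
Definition imx_swap p q := IMatrix (imx_swap_proof p q).

End InfiniteMatrices.

Arguments imx1 {K}.
Arguments imx_E {K}.
Arguments imx_T1 {K}.
Arguments imx_swap {K}.

Section Hierarchies.
Variables (K : fieldType) (F : comAlgType K).
Implicit Types (f g r : F) (G R : set F) (P E : F -> F).

Definition alg_morphism (A C : comAlgType K) (h : A -> C) : Prop :=
  linear h /\ monoid_morphism h.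

Record subalgebra G : Prop := Subalgebra {
  subalg1 : G 1;
  subalgL : forall (a : K) f g, G f -> G g -> G (a *: f + g);
  subalgM : forall f g, G f -> G g -> G (f * g)
}.

Definition constants : set F := [set r | exists a : K, r = a%:A].

Record rota_baxter_operator P : Prop := RotaBaxterOperator {
  rbo_linear : linear P;
  rbo_axiom : forall f g, P f * P g = P (f * P g) + P (P f * g)
}.

(* (G, P) is an ordinary Rota-Baxter algebra over the subring R of G.        *)
Record ordinary_rota_baxter R G P : Prop := OrdinaryRotaBaxter {
  orb_scalars : R `<=` G;
  orb_stable : forall f, G f -> G (P f);
  orb_linear : forall r f g, R r -> G f -> G g -> P (r * f + g) = r * P f + P g;
  orb_axiom : forall f g, G f -> G g -> P f * P g = P (f * P g) + P (P f * g);
  orb_inj : forall f g, G f -> G g -> P f = P g -> f = g;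
  orb_sum : forall g, G g -> exists r f, [/\ R r, G f & g = r + P f];
  orb_direct : forall r f, R r -> G f -> r = P f -> r = 0
}.

(* E is the projector of G onto R along the image of P.                      *)
Definition evaluation_of R G P E : Prop :=
  forall r f, R r -> G f -> E (r + P f) = r.

Variables (Fn : nat -> set F) (act : imatrix K -> F -> F).

Record hierarchy : Prop := Hierarchy {
  hier0 : Fn 0 = constants;
  hier_subalg : forall n, subalgebra (Fn n);
  hier_incl : forall n, Fn n `<=` Fn n.+1;
  hier_union : forall f, exists n, Fn n f;
  hier_morph : forall M, alg_morphism (act M);
  hier_act1 : forall f, act imx1 f = f;
  hier_actM : forall M N f, act (imx_mul M N) f = act N (act M f);
  hier_straight : forall n M f, Fn n f -> act M f = act (imx_trunc n M) f;
  hier_preserve : forall n (M : 'M[K]_n) f, Fn n f -> Fn n (act (imx_mx M) f);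
  hier_eval : forall n f, Fn n.+1 f -> Fn n (act (imx_E n) f)
}.

Variable int : nat -> F -> F.

(* The operator int n belongs to the variable x_{n+1}, whereas Fn n is the   *)
(* n-th algebra F_n: hence n < m below where one writes n <= m on paper.     *)
Record rota_baxter_hierarchy : Prop := RotaBaxterHierarchy {
  rbh_hierarchy : hierarchy;
  rbh_operator : forall n, rota_baxter_operator (int n);
  rbh_commute : forall i k f, int i (int k f) = int k (int i f);
  rbh_stable : forall n m f, (n < m)%N -> Fn m f -> Fn m (int n f);
  rbh_shift : forall n m M f, (n < m)%N ->
    int n (act (imx_shift m M) f) = act (imx_shift m M) (int n f);
  rbh_ordinary : forall n, ordinary_rota_baxter (Fn n) (Fn n.+1) (int n);
  rbh_evaluation : forall n,
    evaluation_of (Fn n) (Fn n.+1) (int n) (act (imx_E n));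
  rbh_swap : forall i k f, i != k ->
    act (imx_swap i k) (int i f) = int k (act (imx_swap i k) f);
  rbh_scal : forall (c : K) f, c != 0 ->
    int 0 (act (imx_scal c) f) = c^-1 *: act (imx_scal c) (int 0 f);
  rbh_T1 : forall f, int 0 (act imx_T1 f) =
    act imx_T1 (int 0 f) - act (imx_E 0) (act imx_T1 (int 0 f));
  rbh_L : forall m (v : 'cV[K]_m) f,
    let e1 : 'cV[K]_(1 + m) := delta_mx 0 0 in
    let v0 : 'cV[K]_(1 + m) := col_mx 0 v in
    let bracket g := act (imx_L 0 e1) (int 0 g) - int 0 (act (imx_L 0 e1) g) in
    int 0 (act (imx_L 0 (e1 + v0)) (int 0 f)) =
    act (imx_L 1 (- v)) (bracket (int 1 (act (imx_L 1 v) f)))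
}.

End Hierarchies.

Section Bialgebras.
Variables (K : fieldType) (B : comAlgType K).
Variables (Delta : B -> tensor B B) (eps : B -> K^o).
Implicit Types (b : B) (P f g : B -> B).

Record bialgebra : Prop := Bialgebra {
  bialg_comult : alg_morphism (Delta : B -> (tensor B B : comAlgType K));
  bialg_counit : alg_morphism (eps : B -> (K^o : comAlgType K));
  bialg_coassoc : forall b,
    tassoc (tmap Delta id (Delta b)) = tmap id Delta (Delta b);
  bialg_counitl : forall b, tlift (fun x y => eps x *: y) (Delta b) = b;
  bialg_counitr : forall b, tlift (fun x y => eps y *: x) (Delta b) = b;
  bialg_cocomm : forall b, tswap (Delta b) = Delta b
}.

Definition bi_e (b : B) : B := (eps b)%:A.

Definition convolution f g (b : B) : B :=
  tlift (fun x y => x * y) (tmap f g (Delta b)).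

Record bialg_endo (f : B -> B) : Prop := BialgEndo {
  bendo_morph : alg_morphism f;
  bendo_comult : forall b, Delta (f b) = tmap f f (Delta b);
  bendo_counit : forall b, eps (f b) = eps b
}.

Record rota_baxter_bialgebra P : Prop := RotaBaxterBialgebra {
  rbb_bialgebra : bialgebra;
  rbb_ordinary : ordinary_rota_baxter (@constants K B) [set: B] P;
  rbb_evaluation : evaluation_of (@constants K B) [set: B] P bi_e;
  rbb_comult : forall b,
    Delta (P b) = tmap P id (Delta b) + tmap bi_e id (Delta (P b))
}.

(* The scaling extended by 0^* := e; the value of sc at 0 is irrelevant.    *)
Definition scaling0 (sc : K -> B -> B) (c : K) : B -> B :=
  if c == 0 then bi_e else sc c.

Record scaling P (sc : K -> B -> B) : Prop := Scaling {
  scal_endo : forall c, c != 0 -> bialg_endo (sc c);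
  scal_1 : forall b, sc 1 b = b;
  scal_M : forall c d b, c != 0 -> d != 0 -> sc (c * d) b = sc c (sc d b);
  scal0_M : forall c d b,
    scaling0 sc (c * d) b = scaling0 sc c (scaling0 sc d b);
  scal0_D : forall c d b,
    scaling0 sc (c + d) b = convolution (scaling0 sc c) (scaling0 sc d) b;
  scal_int : forall c b, c != 0 -> P (sc c b) = c^-1 *: sc c (P b)
}.

Record scaled_rota_baxter_bialgebra P (sc : K -> B -> B) : Prop :=
    ScaledRotaBaxterBialgebra {
  srbb_rbb : rota_baxter_bialgebra P;
  srbb_scaling : scaling P sc
}.

End Bialgebras.

Section TensorPowers.
Variables (K : fieldType) (B : comAlgType K).

(* tpow 1 is K (x) B, identified with B through b |-> 1 \ox b.              *)
Fixpoint tpow (n : nat) : comAlgType K :=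
  match n with
  | 0 => K^o
  | n'.+1 => tensor (tpow n') B
  end.

Definition tpow_in n (x : tpow n) : tpow n.+1 := x \ox 1.

Lemma tpow_in_linear n : linear (@tpow_in n).
Proof. by move=> a x y; rewrite /tpow_in tensDl tensZl. Qed.

Lemma tpow_in_monoid_morphism n : monoid_morphism (@tpow_in n).
Proof. by split=> // x y; rewrite /tpow_in [RHS]tensM mulr1. Qed.

HB.instance Definition _ n :=
  GRing.isLinear.Build K (tpow n) (tpow n.+1) _ (@tpow_in n)
    (@tpow_in_linear n).
HB.instance Definition _ n :=
  GRing.isMonoidMorphism.Build (tpow n) (tpow n.+1) (@tpow_in n)
    (@tpow_in_monoid_morphism n).

Definition tpow_incl n : {lrmorphism tpow n -> tpow n.+1} := @tpow_in n.

Definition Hlim : comAlgType K := dlim tpow_incl.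

Definition Hin n (x : tpow n) : Hlim := dl_in tpow_incl x.

(* f_0 (x) ... (x) f_{n-1} *)
Fixpoint tpow_map (f : nat -> B -> B) (n : nat) : tpow n -> tpow n :=
  match n with
  | 0 => id
  | n'.+1 => tmap (@tpow_map f n') (f n')
  end.

Definition Hlevel (n : nat) : set Hlim := range (@Hin n).

(* id (x) ... (x) id (x) P (x) id (x) ... (x) id with P in position i < n    *)
Definition tpow_int (P : B -> B) (i n : nat) : tpow n -> tpow n :=
  tpow_map (fun k => if k == i then P else id) (n := n).

Definition Hint (P : B -> B) (i : nat) (x : Hlim) : Hlim :=
  let N := maxn (dl_level x) i.+1 in
  Hin (tpow_int P i (up tpow_incl N (dl_repr x))).

Variables (Delta : B -> tensor B B) (eps : B -> K^o) (sc : K -> B -> B).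

(* The iterated coproduct, with the convention that for n = 0 it is eps.     *)
Fixpoint tpow_comult (n : nat) : B -> tpow n :=
  match n with
  | 0 => eps
  | n'.+1 =>
      match n' return (B -> tpow n') -> B -> tpow n'.+1 with
      | 0 => fun _ b => 1 \ox b
      | _.+1 => fun D b => tmap D id (Delta b)
      end (tpow_comult n')
  end.

(* a^* for the row a = (a 0, ..., a (n-1)) *)
Definition row_act (a : nat -> K) (n : nat) (b : B) : tpow n :=
  tpow_map (fun k => scaling0 eps sc (a k)) (tpow_comult n b).

(* f_0 (x) ... (x) f_{n-1} |-> (M_0^* f_0) ... (M_{n-1}^* f_{n-1}), where     *)
(* the rows of M are cut off at length N.                                    *)
Fixpoint rows_act (M : nat -> nat -> K) (N n : nat) : tpow n -> tpow N :=
  match n with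
  | 0 => fun c : K => c%:A
  | n'.+1 => tlift (fun x b => @rows_act M N n' x * row_act (M n') N b)
  end.

(* M is viewed in M_N(K) and x in B_N, for a common N.                       *)
Definition Hact (M : imatrix K) (x : Hlim) : Hlim :=
  let N := maxn (dl_level x) (imx_bound M) in
  Hin (rows_act M N (up tpow_incl N (dl_repr x))).

End TensorPowers.

(* Main.v *)
Require Import Defs.
From HB Require Import structures.
From mathcomp Require Import all_boot all_algebra.
From mathcomp Require Import boolp classical_sets.

Set Implicit Arguments.
Unset Strict Implicit.
Unset Printing Implicit Defensive.

Import GRing.Theory.
Local Open Scope ring_scope.

(** Write G(C) for the set of algebra morphisms from [B] to a commutative
    algebra C, the points of B with values in C.  Convolution makes G(C) a
    commutative monoid, because B is cocommutative, and the scaling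
    [c *: x := x \o c^*] makes it a vector space over K: the semiring law of
    the scaling is the distributivity over scalars, and [-1 *: x] is the
    inverse of [x].  This structure is natural in C.

    Let [emb i], in G(H(B)), be the insertion of B as the i-th tensor factor;
    the images of the [emb i] generate H(B).  The action of a matrix M is the
    algebra endomorphism that sends the point [emb i] to the point
    [\sum_j M i j *: emb j] ([Hact_emb]): matrices act by linear substitution
    of the variables.  The axioms on the action alone thus become linear
    algebra in the vector space G(H(B)).

    The operator of the i-th variable is the linear map with
    [r * emb i a |-> r * emb i (P a)] for every [r] generated by the other
    variables ([Hint_tens]), and such products span H(B) ([Hlim_ind1]).  The
    Rota-Baxter axiom, the commutation rules, and the rules for
    transpositions and scalars are read off on these products.  An ordinary
    operator P has a linear left inverse Q with [id = e + P \o Q]; as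
    [E_n^*] is [e] applied to the variable n ([Hact_E]), this identity makes
    every integral of the hierarchy ordinary; its evaluation is [E_n^*] because
    [e \o P = 0].

    The rule for [T_1(e_1)] is the compatibility of [Delta] with [P].  The
    last rule reduces to the case v' = 0, because
    [L_1(e_1 + v)^* = L_2(-v')^* L_1(e_1)^* L_2(v')^*] ([Hact_L_conj]) and
    [L_2(v')^*] commutes with the first integral.  For v' = 0 it is an
    identity in two variables ([Hint_L_e1]) that the compatibility of [Delta]
    with [P] turns into the Rota-Baxter axiom of the first variable. *)

(** * Linear maps out of tensor products *)

Section LinearMaps.
Variables (K : fieldType) (U V W : lmodType K).
Implicit Types (f : U -> V).

Lemma lin0 f : linear f -> f 0 = 0.
Proof. by move=> lf; have := lf (-1) 0 0; rewrite !scaleN1r !addNr. Qed.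
Lemma linD f : linear f -> {morph f : x y / x + y}.
Proof. by move=> lf x y; have := lf 1 x y; rewrite !scale1r. Qed.
Lemma linZ f c : linear f -> {morph f : x / c *: x}.
Proof. by move=> lf x; have := lf c x 0; rewrite !addr0 lin0 // addr0. Qed.
Lemma linB f : linear f -> {morph f : x y / x - y}.
Proof. by move=> lf x y; rewrite -!scaleN1r linD // linZ. Qed.
Lemma linear_id : linear (@id U).
Proof. by []. Qed.
Lemma linear_comp (g : V -> W) f : linear g -> linear f -> linear (g \o f).
Proof. by move=> lg lf c x y /=; rewrite lf lg. Qed.

End LinearMaps.

Section Bilinear.
Variables (K : fieldType) (U V W : lmodType K).

Lemma mul_bilin (C : comAlgType K) (f : U -> C) (g : V -> C) :
  linear f -> linear g -> bilinear_for *:%R *:%R (fun x y => f x * g y).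
Proof.
move=> lf lg; split=> [y c x x'|x c y y'] /=.
  by rewrite lf mulrDl scalerAl.
by rewrite lg mulrDr scalerAr.
Qed.

Lemma tlift_eq (b b' : U -> V -> W) x :
  (forall u v, b u v = b' u v) -> tlift b x = tlift b' x.
Proof. by move=> e; apply: eq_bigr => p _. Qed.

Lemma tensor_linear_ext (f g : tensor U V -> W) : linear f -> linear g ->
  (forall u v, f (u \ox v) = g (u \ox v)) -> f =1 g.
Proof.
move=> lf lg e; elim/tensor_ind => [|x y IHx IHy|//].
  by rewrite !lin0.
by rewrite linD // IHx IHy linD.
Qed.
End Bilinear.

Section TensorMapTheory.
Variables (K : fieldType) (V V' W W' : lmodType K).
Variables (f : V -> V') (g : W -> W').
Hypotheses (lf : linear f) (lg : linear g).

Lemma tmap_bilin : bilinear_for *:%R *:%R (fun v w => f v \ox g w).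
Proof.
split=> [y c x x'|x c y y'] /=.
  by rewrite lf tensDl tensZl.
by rewrite lg tensDr tensZr.
Qed.

Lemma tmap_linear : linear (tmap f g).
Proof. exact: tlift_linear tmap_bilin. Qed.

Lemma tmap_tens v w : tmap f g (v \ox w) = f v \ox g w.
Proof. exact: tlift_tens tmap_bilin v w. Qed.

Lemma tlift_tmap (U : lmodType K) (b : V' -> W' -> U) x :
  bilinear_for *:%R *:%R b ->
  tlift b (tmap f g x) = tlift (fun v w => b (f v) (g w)) x.
Proof.
move=> bb.
have bb' : bilinear_for *:%R *:%R (fun v w => b (f v) (g w)).
  split=> [y c u u'|u c y y'] /=; first by rewrite lf bb.1.
  by rewrite lg bb.2.
move: x; apply: tensor_linear_ext.
- by apply: linear_comp tmap_linear; exact: tlift_linear.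
- exact: tlift_linear.
- by move=> v w; rewrite tmap_tens !tlift_tens.
Qed.

Lemma linear_tlift (U U' : lmodType K) (h : U -> U') (b : V -> W -> U) x :
  linear h -> bilinear_for *:%R *:%R b ->
  h (tlift b x) = tlift (fun v w => h (b v w)) x.
Proof.
move=> lh bb.
have bb' : bilinear_for *:%R *:%R (fun v w => h (b v w)).
  split=> [y c u u'|u c y y'] /=; first by rewrite bb.1 lh.
  by rewrite bb.2 lh.
move: x; apply: tensor_linear_ext.
- by apply: linear_comp lh _; exact: tlift_linear.
- exact: tlift_linear.
- by move=> v w; rewrite !tlift_tens.
Qed.
End TensorMapTheory.

(** * The coproduct of commutative algebras *)

Section AlgMorphisms.
Variables (K : fieldType) (A B C : comAlgType K).

Lemma amorphL (h : A -> C) : alg_morphism h -> linear h. Proof. by case. Qed.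
Lemma amorph1 (h : A -> C) : alg_morphism h -> h 1 = 1.
Proof. by case=> _ []. Qed.
Lemma amorphM (h : A -> C) : alg_morphism h -> {morph h : x y / x * y}.
Proof. by case=> _ []. Qed.
Lemma amorphA (h : A -> C) c : alg_morphism h -> h c%:A = c%:A.
Proof. by move=> mh; rewrite (linZ _ (amorphL mh)) amorph1. Qed.

End AlgMorphisms.

Section Copair.
Variables (K : fieldType) (A B C : comAlgType K).

Lemma alg_morphism_comp (g : B -> C) (f : A -> B) :
  alg_morphism g -> alg_morphism f -> alg_morphism (g \o f).
Proof.
move=> mg mf; split; first exact: linear_comp (amorphL mg) (amorphL mf).
by split=> [|x y] /=; rewrite (amorph1, amorphM) // (amorph1, amorphM).
Qed.

(** The tensor product is the coproduct of commutative algebras; this is the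
    morphism out of it with components [f] and [g]. *)
Definition copair (f : A -> C) (g : B -> C) : tensor A B -> C :=
  tlift (fun x y => f x * g y).

Variables (f : A -> C) (g : B -> C).

Section CopairLinear.
Hypotheses (lf : linear f) (lg : linear g).
Lemma copair_linear : linear (copair f g).
Proof. exact: tlift_linear (mul_bilin lf lg). Qed.
Lemma copair_tens x y : copair f g (x \ox y) = f x * g y.
Proof. exact: tlift_tens (mul_bilin lf lg) x y. Qed.
End CopairLinear.

Hypotheses (mf : alg_morphism f) (mg : alg_morphism g).
Let lf := amorphL mf.
Let lg := amorphL mg.

Lemma copair_morphism : alg_morphism (copair f g).
Proof.
have lc := copair_linear lf lg.
split=> //; split=> [|x y].
  by rewrite [1]/(1 \ox 1) copair_tens // (amorph1 mf) (amorph1 mg) mulr1.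
elim/tensor_ind: x => [|x x' IH IH'|a b].
- by rewrite mul0r !(lin0 lc) mul0r.
- by rewrite mulrDl !(linD lc) IH IH' mulrDl.
elim/tensor_ind: y => [|y y' IH IH'|a' b'].
- by rewrite mulr0 !(lin0 lc) mulr0.
- by rewrite mulrDr !(linD lc) IH IH' mulrDr.
by rewrite tensM !copair_tens // (amorphM mf) (amorphM mg) mulrACA.
Qed.
End Copair.

(** * The vector space of points of a scaled bialgebra *)

Section Points.
Variables (K : fieldType) (B : comAlgType K).
Variables (Delta : B -> tensor B B) (eps : B -> K^o).
Variables (P : B -> B) (sc : K -> B -> B).

(** The bialgebra data index the type, so that the vector space structure below,
    which depends on them, is determined by the type. *)
Record points (Bsc : scaled_rota_baxter_bialgebra Delta eps P sc)
  (C : comAlgType K) := Point { pt_fun :> B -> C; ptP : alg_morphism pt_fun }.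

Variable Bsc : scaled_rota_baxter_bialgebra Delta eps P sc.

Let Bbi : bialgebra Delta eps := rbb_bialgebra (srbb_rbb Bsc).
Let Bscal : scaling Delta eps P sc := srbb_scaling Bsc.
Local Notation sc0 := (scaling0 eps sc).
Let mDelta : alg_morphism Delta := bialg_comult Bbi.
Let lDelta : linear Delta := amorphL mDelta.
Let meps : alg_morphism (eps : B -> (K^o : comAlgType K)) := bialg_counit Bbi.
Let leps : linear eps := amorphL meps.

Lemma copair_coassoc (C : comAlgType K) (f g h : B -> C) b :
  linear f -> linear g -> linear h ->
  copair f (copair g h \o Delta) (Delta b) =
  copair (copair f g \o Delta) h (Delta b).
Proof.
move=> lf lg lh.
have lgh := copair_linear lg lh; have lfg := copair_linear lf lg.
pose T : tensor B (tensor B B) -> C := copair f (copair g h).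
have lT : linear T by exact: copair_linear.
have lid := @linear_id K B.
have -> : copair f (copair g h \o Delta) (Delta b) =
    T (tmap id Delta (Delta b)).
  by rewrite /T /copair tlift_tmap //; exact: mul_bilin.
rewrite -(bialg_coassoc Bbi).
have -> : copair (copair f g \o Delta) h (Delta b) =
    copair (copair f g) h (tmap Delta id (Delta b)).
  by rewrite {3}/copair tlift_tmap //; exact: mul_bilin.
move: (tmap _ _ _).
have bas (w : B) : bilinear_for *:%R *:%R (fun u v : B => u \ox (v \ox w)).
  by split=> [y c x x'|x c y y'] /=; rewrite !(tensDl, tensZl, tensDr, tensZr).
have ba : bilinear_for *:%R *:%R
    (fun (x : tensor B B) (w : B) => tlift (fun u v => u \ox (v \ox w)) x).
  split=> [y c x x'|x c y y'] /=; first by rewrite tlift_linear.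
  elim/tensor_ind: x => [|x x' IH IH'|u v].
  - by rewrite !(lin0 (tlift_linear (bas _))) scaler0 addr0.
  - by rewrite !(linD (tlift_linear (bas _))) IH IH' scalerDr addrACA.
  - by rewrite !tlift_tens // !(tensDr, tensZr).
have la : linear (@tassoc K B B B) by apply: (tlift_linear ba).
apply: tensor_linear_ext => [||x w].
- exact: linear_comp.
- exact: copair_linear.
rewrite /= /tassoc tlift_tens // copair_tens //.
move: x; apply: tensor_linear_ext => [||u v].
- by apply: (@linear_comp _ _ _ _ T) => //; exact: tlift_linear.
- by move=> c x y; rewrite copair_linear // mulrDl scalerAl.
- by rewrite tlift_tens // /T !copair_tens // mulrA.
Qed.

Lemma copair_cocomm (C : comAlgType K) (f g : B -> C) b :
  linear f -> linear g -> copair f g (Delta b) = copair g f (Delta b).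
Proof.
move=> lf lg; rewrite -{1}(bialg_cocomm Bbi).
have bs : bilinear_for *:%R *:%R (fun v w : B => w \ox v).
  by split=> [y c x x'|x c y y'] /=; rewrite !(tensDl, tensZl, tensDr, tensZr).
move: (Delta b); apply: tensor_linear_ext => [||u v].
- apply: linear_comp; first exact: copair_linear.
  exact: tlift_linear.
- exact: copair_linear.
- by rewrite /= /tswap tlift_tens // !copair_tens // mulrC.
Qed.

Lemma counit_bilin : bilinear_for *:%R *:%R (fun x y : B => eps x *: y).
Proof.
split=> [y c x x'|x c y y'] /=; first by rewrite leps scalerDl scalerA.
by rewrite scalerDr !scalerA mulrC.
Qed.

(** Here [h] is [eps] followed by the inclusion of the line [K u]; this covers
    both the empty iterated coproduct and the projector [bi_e eps]. *)
Lemma tmap_counitl (V : lmodType K) (h : B -> V) u b :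
  (forall x, h x = eps x *: u) -> tmap h id (Delta b) = @tens K V B u b.
Proof.
move=> he; have bb := counit_bilin.
have lh : linear h by move=> c x y; rewrite !he leps scalerDl scalerA.
rewrite -[in RHS](bialg_counitl Bbi b); move: (Delta b).
apply: tensor_linear_ext => [||v w]; first exact: tmap_linear.
  by move=> c x y; rewrite tlift_linear // tensDr tensZr.
by rewrite tmap_tens // tlift_tens // he tensZl tensZr.
Qed.

(** The zero scaling, which is the projector [bi_e eps], respects the bialgebra
    structure too; hence all scalars act on points in the same way. *)
Lemma scaling0_endo c : bialg_endo Delta eps (sc0 c).
Proof.
rewrite /scaling0; case: eqP => [_|/eqP c0]; last exact: (scal_endo Bscal).
have mid : alg_morphism (@bi_e K B eps).
  split=> [a x y|]; first by rewrite /bi_e leps scalerDl scalerA.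
  split=> [|x y]; first by rewrite /bi_e (amorph1 meps) scale1r.
  by rewrite /bi_e (amorphM meps) -scalerAl mul1r scalerA.
split=> // b; last by rewrite /bi_e (linZ _ leps) (amorph1 meps) [_ *: _]mulr1.
rewrite /bi_e (amorphA _ mDelta).
rewrite -{1}(bialg_counitl Bbi b); have bb := counit_bilin.
move: (Delta b); apply: tensor_linear_ext => [||u v].
- move=> d x y; rewrite tlift_linear // leps.
  by rewrite scalerDl scalerA.
- by apply: tmap_linear; case: mid.
- rewrite tlift_tens // (linZ _ leps) tmap_tens; [|by case: mid..].
  by rewrite tensZl tensZr scalerA.
Qed.

Lemma scaling01 b : sc0 1 b = b.
Proof. by rewrite /scaling0 oner_eq0 (scal_1 Bscal). Qed.

Lemma scaling00 b : sc0 0 b = (eps b)%:A.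
Proof. by rewrite /scaling0 eqxx. Qed.

Variable C : comAlgType K.
Implicit Types (x y z : points Bsc C).

HB.instance Definition _ := gen_eqMixin (points Bsc C).
HB.instance Definition _ := gen_choiceMixin (points Bsc C).

Lemma pt_linear x : linear x. Proof. by case: (ptP x). Qed.
Hint Resolve ptP pt_linear : core.

Lemma points_eq x y : x =1 y -> x = y.
Proof.
case: x y => [f fP] [g gP] /= /funext e; subst g.
by congr Point; exact: Prop_irrelevance.
Qed.

Definition pt_zero : points Bsc C.
Proof.
apply: (@Point _ _ (fun b => (eps b)%:A)); split=> [a x y|].
  by rewrite leps scalerDl scalerA.
split=> [|x y]; first by rewrite (amorph1 meps) scale1r.
by rewrite (amorphM meps) -scalerAl mul1r scalerA.
Defined.

Definition pt_add x y : points Bsc C :=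
  Point _ (alg_morphism_comp (copair_morphism (ptP x) (ptP y)) mDelta).

Definition pt_scale c x : points Bsc C :=
  Point _ (alg_morphism_comp (ptP x) (bendo_morph (scaling0_endo c))).

Definition pt_opp x := pt_scale (-1) x.

Lemma pt_addA : associative pt_add.
Proof. by move=> x y z; apply: points_eq => b /=; exact: copair_coassoc. Qed.

Lemma pt_addC : commutative pt_add.
Proof. by move=> x y; apply: points_eq => b /=; exact: copair_cocomm. Qed.

Lemma pt_add0 : left_id pt_zero pt_add.
Proof.
move=> x; apply: points_eq => b /=; rewrite -[in RHS](bialg_counitl Bbi b).
rewrite (linear_tlift _ (pt_linear x) counit_bilin).
by apply: tlift_eq => u v; rewrite -scalerAl mul1r (linZ _ (pt_linear x)).
Qed.

Lemma pt_scaleDl x : {morph pt_scale^~ x : c d / c + d >-> pt_add c d}.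
Proof.
move=> c d; apply: points_eq => b /=; rewrite (scal0_D Bscal) /convolution.
have lc e : linear (sc0 e) by exact: (amorphL (bendo_morph (scaling0_endo e))).
rewrite tlift_tmap //; last exact: (@mul_bilin K B B B id id).
rewrite (linear_tlift _ (pt_linear x)); last exact: mul_bilin.
by apply: tlift_eq => u v; rewrite (amorphM (ptP x)).
Qed.

Lemma pt_scale0 x : pt_scale 0 x = pt_zero.
Proof.
by apply: points_eq => b /=; rewrite scaling00 (amorphA _ (ptP x)).
Qed.

Lemma pt_scale1 : left_id 1 pt_scale.
Proof. by move=> x; apply: points_eq => b /=; rewrite scaling01. Qed.

Lemma pt_addN : left_inverse pt_zero pt_opp pt_add.
Proof.
by move=> x; rewrite /pt_opp -{2}[x]pt_scale1 -pt_scaleDl addNr pt_scale0.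
Qed.

HB.instance Definition _ := GRing.isZmodule.Build (points Bsc C)
  pt_addA pt_addC pt_add0 pt_addN.

Lemma pt_scaleA c d x : pt_scale c (pt_scale d x) = pt_scale (c * d) x.
Proof.
by apply: points_eq => b; rewrite mulrC /= (scal0_M Bscal).
Qed.

Lemma pt_scaleDr : right_distributive pt_scale +%R.
Proof.
move=> c x y; apply: points_eq => b /=.
rewrite (bendo_comult (scaling0_endo c)).
have lc : linear (sc0 c) by exact: (amorphL (bendo_morph (scaling0_endo c))).
by rewrite /copair tlift_tmap //; exact: mul_bilin.
Qed.

HB.instance Definition _ := GRing.Zmodule_isLmodule.Build K (points Bsc C)
  pt_scaleA pt_scale1 pt_scaleDr pt_scaleDl.

Lemma pt0E b : (0 : points Bsc C) b = (eps b)%:A. Proof. by []. Qed.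
Lemma ptDE x y b : (x + y) b = copair x y (Delta b). Proof. by []. Qed.
Lemma ptZE c x b : (c *: x) b = x (sc0 c b). Proof. by []. Qed.
End Points.

(** Points are natural in the target algebra: this is G(h) : G(C) -> G(D). *)
Definition pt_push (K : fieldType) (B : comAlgType K) Delta eps P sc
  (Bsc : @scaled_rota_baxter_bialgebra K B Delta eps P sc)
  (C D : comAlgType K) (h : C -> D) (mh : alg_morphism h) (x : points Bsc C) :
  points Bsc D := Point _ (alg_morphism_comp mh (ptP x)).

(** * Variables of the induced hierarchy *)

Section PowerLimit.
Variables (K : fieldType) (B : comAlgType K).
Local Notation H := (Hlim B).
Local Notation up := (up (@tpow_incl K B)).
Local Notation Hin := (@Hin K B).

Lemma Hin_morphism n : alg_morphism (@Hin n).
Proof. by split; [exact: dl_in_linear|exact: dl_in_monoid_morphism]. Qed.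

Lemma Hin_up n m (x : tpow B n) : (n <= m)%N -> Hin (up m x) = Hin x.
Proof. exact: dl_in_up. Qed.

Lemma upS_tens n m (x : tpow B n) : (n <= m)%N -> up m.+1 x = up m x \ox 1.
Proof. exact: upS. Qed.

Lemma Hin_tens1 n (x : tpow B n) : Hin (n := n.+1) (x \ox 1) = Hin x.
Proof. by rewrite -[in LHS](up_id (tpow_incl B) x) -upS_tens // Hin_up. Qed.

Lemma Hin_surj (f : H) m : exists n (x : tpow B n), (m <= n)%N /\ f = Hin x.
Proof.
have [n hn] := dl_in_le f; exists (maxn n m).
by have [x ->] := hn _ (leq_maxl n m); exists x; rewrite leq_maxr.
Qed.

Lemma Hin_surj2 (f g : H) m :
  exists n (x y : tpow B n), [/\ (m <= n)%N, f = Hin x & g = Hin y].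
Proof.
have [n [x [_ ->]]] := Hin_surj f m; have [p [y [mp ->]]] := Hin_surj g m.
exists (maxn n p), (up _ x), (up _ y).
by rewrite leq_max mp orbT !Hin_up ?leq_maxl ?leq_maxr.
Qed.

(** Insertion of an element of B as the tensor factor number [i]; a function of
    the variable x_(i+1) alone. *)
Definition emb (i : nat) (b : B) : H := Hin (n := i.+1) ((1 : tpow B i) \ox b).

Lemma HinS n (x : tpow B n) b : Hin (n := n.+1) (x \ox b) = Hin x * emb n b.
Proof.
rewrite -(Hin_tens1 x) /emb -(amorphM (Hin_morphism n.+1)); congr Hin.
by rewrite [RHS]tensM mulr1 mul1r.
Qed.

Lemma emb_morphism i : alg_morphism (emb i).
Proof.
have := Hin_morphism i.+1; rewrite /emb => mh; split=> [c x y|].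
  by rewrite tensDr tensZr (amorphL mh).
split=> [|x y]; first exact: (amorph1 mh).
by rewrite -(amorphM mh); congr Hin; rewrite [RHS]tensM mulr1.
Qed.

Lemma Hin0 (c : K) : Hin (n := 0) c = c%:A.
Proof.
rewrite -(amorphA c (Hin_morphism 0)); congr Hin.
by rewrite [RHS]mulr1.
Qed.

(** The subalgebra generated by the variables with index in [S].  It replaces
    explicit tensors: being independent of a variable, belonging to a level of
    the filtration, and being fixed by a substitution are all read off from
    the set of variables involved. *)
Inductive gen (S : pred nat) : H -> Prop :=
| genA c : gen S c%:A
| gen_emb i b : S i -> gen S (emb i b)
| genD f g : gen S f -> gen S g -> gen S (f + g)
| genM f g : gen S f -> gen S g -> gen S (f * g).

Lemma gen0 S : gen S 0.
Proof. by rewrite -(scale0r 1); exact: genA. Qed.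
Lemma gen1 S : gen S 1.
Proof. by rewrite -(scale1r 1); exact: genA. Qed.
Lemma genZ S c f : gen S f -> gen S (c *: f).
Proof. by move=> gf; rewrite -mulr_algl; apply: genM gf; exact: genA. Qed.

Lemma gen_Hin n (x : tpow B n) : gen (fun i => (i < n)%N) (Hin x).
Proof.
suff h m (y : tpow B m) : (m <= n)%N -> gen (fun i => (i < n)%N) (Hin y).
  exact: h.
elim: m y => [|m IH] y mn; first by rewrite Hin0; exact: genA.
have mh := Hin_morphism m.+1.
elim/tensor_ind: y => [|x1 x2 h1 h2|u v].
- by rewrite (lin0 (amorphL mh)); exact: gen0.
- by rewrite (linD (amorphL mh)); exact: genD.
- by rewrite HinS; apply: genM; [apply: IH; exact: ltnW|exact: gen_emb].
Qed.

Lemma HlevelP n (f : H) : @Hlevel K B n f <-> gen (fun i => (i < n)%N) f.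
Proof.
split=> [[x _ <-]|]; first exact: gen_Hin.
have mh := Hin_morphism n.
elim=> {f} [c|i b ltin|f g _ [x _ <-] _ [y _ <-]|f g _ [x _ <-] _ [y _ <-]].
- by exists c%:A => //; exact: amorphA.
- by exists (up n ((1 : tpow B i) \ox b : tpow B i.+1)) => //; exact: Hin_up.
- by exists (x + y) => //; exact: (linD (amorphL mh)).
- by exists (x * y) => //; exact: (amorphM mh).
Qed.

Lemma gen_mono (S T : pred nat) f :
  (forall i, S i -> T i) -> gen S f -> gen T f.
Proof.
move=> ST; elim=> {f} [c|i b Si|f g _ gf _ gg|f g _ gf _ gg].
- exact: genA.
- by apply: gen_emb; exact: ST.
- exact: genD.
- exact: genM.
Qed.

Lemma gen_all f : gen predT f.
Proof.
have [n [x [_ ->]]] := Hin_surj f 0.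
exact: gen_mono (gen_Hin x).
Qed.

Lemma gen_morph (S T : pred nat) (h : H -> H) f : alg_morphism h ->
  (forall i b, S i -> gen T (h (emb i b))) -> gen S f -> gen T (h f).
Proof.
move=> mh hT; elim=> {f} [c|i b Si|f g _ gf _ gg|f g _ gf _ gg].
- by rewrite (amorphA _ mh); exact: genA.
- exact: hT.
- by rewrite (linD (amorphL mh)); exact: genD.
- by rewrite (amorphM mh); exact: genM.
Qed.

Lemma eq_on_gen (S : pred nat) (C : comAlgType K) (h h' : H -> C) f :
  alg_morphism h -> alg_morphism h' ->
  (forall i b, S i -> h (emb i b) = h' (emb i b)) -> gen S f -> h f = h' f.
Proof.
move=> mh mh' e; elim=> {f} [c|i b Si|f g _ ef _ eg|f g _ ef _ eg].
- by rewrite !amorphA.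
- exact: e.
- by rewrite (linD (amorphL mh)) (linD (amorphL mh')) ef eg.
- by rewrite (amorphM mh) (amorphM mh') ef eg.
Qed.

Lemma Hlim_eq (C : comAlgType K) (h h' : H -> C) :
  alg_morphism h -> alg_morphism h' ->
  (forall i b, h (emb i b) = h' (emb i b)) -> h =1 h'.
Proof. by move=> mh mh' e f; apply: eq_on_gen (gen_all f) => // i b _. Qed.

Inductive split_sum (S : pred nat) (i : nat) : H -> Prop :=
| split_sum1 r a : gen (predD1 S i) r -> split_sum S i (r * emb i a)
| split_sumD f g : split_sum S i f -> split_sum S i g -> split_sum S i (f + g).

(** Products of separated terms are again separated, because the algebra is
    commutative and [emb i] is multiplicative. *)
Lemma gen_split S i f : gen S f -> split_sum S i f.
Proof.
have e1 : emb i 1 = 1 by exact: amorph1 (emb_morphism i).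
elim=> {f} [c|j b Sj|f g _ sf _ sg|f g _ sf _ sg].
- have -> : c%:A = c%:A * emb i 1 by rewrite e1 mulr1.
  by apply: split_sum1; exact: genA.
- have [->|ji] := eqVneq j i.
    by rewrite -[emb _ _]mul1r; apply: split_sum1; exact: gen1.
  rewrite -[emb j b]mulr1 -e1; apply: split_sum1; apply: gen_emb.
  exact/andP.
- exact: split_sumD.
- elim: sf => {f} [r a gr|f f' _ IH _ IH'].
    elim: sg => {g} [s c gs|g g' _ IH _ IH'].
      rewrite mulrACA -(amorphM (emb_morphism i)).
      by apply: split_sum1; exact: genM.
    by rewrite mulrDr; exact: split_sumD.
  by rewrite mulrDl; exact: split_sumD.
Qed.

(** Additive statements about H(B) need only be checked on products that isolate
    one variable, or, in the next lemma, two variables. *)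
Lemma Hlim_ind1 i (Q : H -> Prop) : (forall f g, Q f -> Q g -> Q (f + g)) ->
  (forall r a, gen (predC1 i) r -> Q (r * emb i a)) -> forall f, Q f.
Proof.
move=> QD Q1 f; elim: (gen_split i (gen_all f)) => {f} [r a gr|f g _ ? _ ?].
  by apply: Q1; apply: gen_mono gr => j /andP[].
exact: QD.
Qed.

Lemma Hlim_ind2 i k : i != k -> forall Q : H -> Prop,
  (forall f g, Q f -> Q g -> Q (f + g)) ->
  (forall r a b, gen (predC (pred2 i k)) r -> Q (r * emb i a * emb k b)) ->
  forall f, Q f.
Proof.
move=> ik Q QD Q2; apply: (@Hlim_ind1 k) => // r b gr.
elim: (gen_split i gr) => {r gr} [r a gr|f g _ ? _ ?].
  apply: Q2; apply: gen_mono gr => j /=.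
  by case/andP=> ji jk; rewrite negb_or ji.
by rewrite mulrDl; exact: QD.
Qed.

(** * Operators acting on one variable *)

Section TpowMap.
Variable q : nat -> B -> B.
Hypothesis lq : forall k, linear (q k).

Lemma tpow_map_linear n : linear (@tpow_map K B q n).
Proof. by elim: n => [//|n IH]; exact: tmap_linear. Qed.

Lemma tpow_mapS n (x : tpow B n) b :
  @tpow_map K B q n.+1 (x \ox b) = tpow_map q x \ox q n b.
Proof. by rewrite /= tmap_tens //; exact: tpow_map_linear. Qed.

Lemma tpow_map_idl n (x : tpow B n) :
  (forall k b, (k < n)%N -> q k b = b) -> tpow_map q x = x.
Proof.
elim: n x => [//|n IH] x qid.
move: x; apply: tensor_linear_ext => [||u v].
- exact: (@tpow_map_linear n.+1).
- by [].
- by rewrite tpow_mapS qid // IH // => k b kn; rewrite qid // leqW.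
Qed.

(** Multiplication by an element of the first [n] factors does not see the
    operators on the later factors. *)
Lemma tpow_map_upM n m (t : tpow B n) x : (n <= m)%N ->
  (forall y, tpow_map q (t * y) = t * tpow_map q y) ->
  tpow_map q (up m t * x) = up m t * tpow_map q x.
Proof.
elim: m x => [|m IH] x.
  by rewrite leqn0 => /eqP n0; subst n; rewrite !up_id.
rewrite leq_eqVlt => /predU1P[e|nm ht]; first by subst n; rewrite !up_id.
have lm := @tpow_map_linear m.+1.
move: x; apply: (@tensor_linear_ext K (tpow B m) B (tpow B m.+1)) =>
  [c x y|c x y|u v].
- by rewrite mulrDr -scalerAr lm.
- by rewrite lm mulrDr scalerAr.
rewrite upS_tens // [X in tpow_map _ X]tensM mul1r !tpow_mapS IH //.
by rewrite [RHS]tensM mul1r.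
Qed.

Lemma tpow_map_up n m (x : tpow B n) : (n <= m)%N ->
  (forall k, (n <= k)%N -> q k 1 = 1) ->
  tpow_map q (up m x) = up m (tpow_map q x).
Proof.
move=> nm q1; elim: m nm => [|m IH].
  by rewrite leqn0 => /eqP n0; subst n; rewrite !up_id.
rewrite leq_eqVlt => /predU1P[e|nm]; first by subst n; rewrite !up_id.
rewrite !upS_tens //.
by rewrite tpow_mapS IH // q1.
Qed.
End TpowMap.

Section HintTheory.
Variables (Q : B -> B) (i : nat).
Hypothesis lQ : linear Q.

Let q k := if k == i then Q else id.
Let lq k : linear (q k). Proof. by rewrite /q; case: eqP. Qed.

(** The operator may be computed at any level that contains the variable,
    because [Q] is not applied to the factors 1 added by the transition maps. *)
Lemma Hint_Hin n (x : tpow B n) : (i < n)%N ->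
  Hint Q i (Hin x) = Hin (tpow_int Q i x).
Proof.
move=> ltin; rewrite /Hint.
have up1 N p (y : tpow B N) : (i < N)%N -> (N <= p)%N ->
    tpow_int Q i (up p y) = up p (tpow_int Q i y).
  move=> iN Np; apply: tpow_map_up => // k Nk; rewrite gtn_eqF //.
  exact: leq_trans iN Nk.
set f := Hin x.
have /dl_inP[M [le1 le2 e]] : Hin (dl_repr f) = Hin x by exact: dl_reprK.
have iM : (i < M)%N by exact: leq_trans le2.
set N := maxn _ _.
have NM : (N <= M)%N by rewrite geq_max le1.
have iN : (i < N)%N by rewrite leq_maxr.
rewrite -(@Hin_up N M) // -[RHS](@Hin_up n M) // -!up1 //.
by rewrite up_up ?leq_maxl // e.
Qed.

Lemma Hint_linear : linear (Hint Q i : H -> H).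
Proof.
move=> c f g; have [n [x [y [ltin -> ->]]]] := Hin_surj2 f g i.+1.
rewrite -(amorphL (Hin_morphism n)) !Hint_Hin // -(amorphL (Hin_morphism n)).
by rewrite /tpow_int (tpow_map_linear lq).
Qed.

Lemma Hint_embM j b f : j != i -> Hint Q i (emb j b * f) = emb j b * Hint Q i f.
Proof.
move=> ji; have [n [x [le ->]]] := Hin_surj f (maxn j i).+1.
have [ltjn ltin] : (j < n)%N /\ (i < n)%N.
  by move: le; rewrite gtn_max => /andP[].
rewrite /emb -(Hin_up _ ltjn) -(amorphM (Hin_morphism n)) !Hint_Hin //.
rewrite -(amorphM (Hin_morphism n)); congr Hin.
rewrite /tpow_int tpow_map_upM //.
apply: (@tensor_linear_ext K (tpow B j) B (tpow B j.+1)) => [c u v|c u v|u v].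
- by rewrite mulrDr -scalerAr (@tpow_map_linear _ lq j.+1).
- by rewrite (@tpow_map_linear _ lq j.+1) mulrDr scalerAr.
rewrite [X in tpow_map _ X]tensM mul1r !(tpow_mapS lq) /q (negPf ji).
by rewrite [RHS]tensM mul1r.
Qed.

Lemma Hint_genM r f : gen (predC1 i) r -> Hint Q i (r * f) = r * Hint Q i f.
Proof.
move=> gr; elim: gr f => {r} [c|j b /= ji|r s _ hr _ hs|r s _ hr _ hs] f.
- by rewrite !mulr_algl (linZ _ Hint_linear).
- exact: Hint_embM.
- by rewrite !mulrDl (linD Hint_linear) hr hs.
- by rewrite -!mulrA hr hs.
Qed.

(** Together with linearity this formula determines the operator. *)
Lemma Hint_tens r a : gen (predC1 i) r ->
  Hint Q i (r * emb i a) = r * emb i (Q a).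
Proof.
move=> gr; rewrite Hint_genM // /emb Hint_Hin //; congr (_ * Hin _).
rewrite /tpow_int (tpow_mapS lq) /q eqxx tpow_map_idl // => k b ki.
by rewrite (ltn_eqF ki).
Qed.
End HintTheory.

End PowerLimit.

(** * Matrices act by linear substitution *)

Section Evaluation.
Variables (K : fieldType) (B C : comAlgType K) (y : nat -> B -> C).
Local Notation up := (up (@tpow_incl K B)).

(** The morphism out of [tpow B n] whose components are the points [y i]: the
    n-fold version of [copair]. *)
Fixpoint ev n : tpow B n -> C :=
  match n with 0 => fun c : K => c%:A | n'.+1 => copair (@ev n') (y n') end.

Hypothesis my : forall i, alg_morphism (y i).

Lemma ev_morphism n : alg_morphism (@ev n).
Proof.
elim: n => [|n IH]; last exact: copair_morphism.
split=> [a u v|] /=; first by rewrite scalerDl scalerA.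
by split=> [|u v] /=; rewrite ?scale1r // -scalerAl mul1r scalerA.
Qed.

Lemma evS n (x : tpow B n) b : ev (n := n.+1) (x \ox b) = ev x * y n b.
Proof. by apply: copair_tens; apply: amorphL => //; exact: ev_morphism. Qed.

Lemma ev_up n m (x : tpow B n) : (n <= m)%N -> ev (up m x) = ev x.
Proof.
elim: m => [|m IH]; first by rewrite leqn0 => /eqP n0; subst n; rewrite up_id.
rewrite leq_eqVlt => /predU1P[e|nm]; first by subst n; rewrite up_id.
by rewrite upS_tens // evS IH // (amorph1 (my m)) mulr1.
Qed.
End Evaluation.

Section Action.
Variables (K : fieldType) (B : comAlgType K).
Variables (Delta : B -> tensor B B) (eps : B -> K^o).
Variables (P : B -> B) (sc : K -> B -> B).
Variable Bsc : scaled_rota_baxter_bialgebra Delta eps P sc.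
Local Notation H := (Hlim B).
Local Notation up := (up (@tpow_incl K B)).
Local Notation Hin := (@Hin K B).
Local Notation emb := (@emb K B).
Local Notation act := (Hact Delta eps sc).

Let Bbi : bialgebra Delta eps := rbb_bialgebra (srbb_rbb Bsc).
Let leps : linear eps := amorphL (bialg_counit Bbi).
Let lDelta : linear Delta := amorphL (bialg_comult Bbi).
Let lsc c : linear (scaling0 eps sc c) :=
  amorphL (bendo_morph (scaling0_endo Bsc c)).

Definition emb_pt i : points Bsc H := Point Bsc (emb_morphism B i).

Definition lincomb (a : nat -> K) n : points Bsc H :=
  \sum_(j < n) a j *: emb_pt j.

Lemma lincombS a n : lincomb a n.+1 = lincomb a n + a n *: emb_pt n.
Proof. by rewrite /lincomb big_ord_recr. Qed.

Lemma lincomb_widen a n m : (forall j, (n <= j)%N -> a j = 0) -> (n <= m)%N ->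
  lincomb a m = lincomb a n.
Proof.
move=> a0; elim: m => [|m IH]; first by rewrite leqn0 => /eqP ->.
rewrite leq_eqVlt => /predU1P[<- //|nm].
by rewrite lincombS a0 // scale0r addr0 IH.
Qed.

Lemma tpow_comult_linear n : linear (tpow_comult Delta eps n).
Proof.
elim: n => [|[|n] IH] //=; first by move=> c x y; rewrite tensDr tensZr.
by apply: linear_comp lDelta; exact: tmap_linear.
Qed.

Lemma tpow_comultS n b :
  tpow_comult Delta eps n.+1 b = tmap (tpow_comult Delta eps n) id (Delta b).
Proof.
case: n => [|n] //=; rewrite (tmap_counitl Bsc (u := 1 : K^o)) // => x.
by rewrite [RHS]mulr1.
Qed.

(** The iterated coproduct followed by the scalings is the linear combination
    [\sum_j a j *: emb j] in the vector space of points. *)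
Lemma Hin_row_act a n b : Hin (row_act Delta eps sc a n b) = lincomb a n b.
Proof.
elim: n b => [|n IH] b.
  by rewrite /lincomb big_ord0 pt0E; exact: Hin0.
rewrite lincombS ptDE /row_act tpow_comultS.
have lc := tpow_comult_linear n.
have lm : linear (tpow_map (fun k => scaling0 eps sc (a k)) (n := n.+1)).
  exact: tpow_map_linear.
have lr : linear (lincomb a n) by exact: pt_linear.
have li : linear (a n *: emb_pt n) by exact: pt_linear.
move: (Delta b); apply: tensor_linear_ext => [||u v].
- apply: (linear_comp (amorphL (Hin_morphism B n.+1))).
  by apply: (linear_comp lm); exact: tmap_linear.
- exact: copair_linear.
rewrite tmap_tens // tpow_mapS // HinS copair_tens // -IH.
by rewrite ptZE.
Qed.

(** The linear form given by the row [i] of [M], as a point.  The sum is cut off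
    at an index beyond which the row vanishes: the diagonal entry may lie
    outside the bound of [M]. *)
Definition row_pt (M : imatrix K) i : points Bsc H :=
  lincomb (M i) (maxn i.+1 (imx_bound M)).

Lemma imx_row_supp (M : imatrix K) i n : (imx_bound M <= n)%N -> (i < n)%N ->
  forall j, (n <= j)%N -> M i j = 0.
Proof.
move=> Mn ltin j nj; rewrite imx_boundP; last by right; exact: leq_trans nj.
by rewrite ltn_eqF //; exact: leq_trans nj.
Qed.

Lemma row_ptE (M : imatrix K) i n : (forall j, (n <= j)%N -> M i j = 0) ->
  row_pt M i = lincomb (M i) n.
Proof.
move=> M0; rewrite /row_pt; set m := maxn _ _.
rewrite -(@lincomb_widen (M i) n (maxn n m)) ?leq_maxl //.
rewrite -[LHS](@lincomb_widen (M i) m (maxn n m)) ?leq_maxr //.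
by apply: imx_row_supp; rewrite /m ?leq_maxr ?leq_maxl.
Qed.

Lemma row_pt_ext (M N : imatrix K) i : (forall j, M i j = N i j) ->
  row_pt M i = row_pt N i.
Proof.
move=> MN; set m := maxn i.+1 (imx_bound M).
have M0 : forall j, (m <= j)%N -> M i j = 0.
  by apply: imx_row_supp; rewrite /m ?leq_maxr ?leq_maxl.
rewrite (row_ptE M0) (@row_ptE N i m) => [|j mj]; last by rewrite -MN M0.
by apply: eq_bigr => j _; rewrite MN.
Qed.

Lemma row_pt_morphism M i : alg_morphism (row_pt M i).
Proof. exact: ptP. Qed.

Lemma Hin_rows_act (M : imatrix K) n N (x : tpow B n) :
  (imx_bound M <= N)%N -> (n <= N)%N ->
  Hin (rows_act Delta eps sc M N x) = ev (row_pt M) x.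
Proof.
move=> MN; elim: n x => [|n IH] x nN.
  by rewrite /= (amorphA _ (Hin_morphism B N)).
have mN := Hin_morphism B N.
have bb : bilinear_for *:%R *:%R (fun (x : tpow B n) b =>
    rows_act Delta eps sc M N x * row_act Delta eps sc (M n) N b).
  apply: mul_bilin.
    elim: n {IH nN x} => [|n IH] /=.
      by move=> c u v; rewrite scalerDl scalerA.
    apply: tlift_linear; apply: mul_bilin => //.
    by apply: linear_comp (tpow_comult_linear N); exact: tpow_map_linear.
  by apply: linear_comp (tpow_comult_linear N); exact: tpow_map_linear.
move: x; apply: (@tensor_linear_ext K (tpow B n) B) => [||u v].
- by apply: (linear_comp (amorphL mN)); exact: tlift_linear.
- exact: (amorphL (ev_morphism (row_pt_morphism M) n.+1)).
rewrite [rows_act _ _ _ _ _ _]tlift_tens // (amorphM mN) IH; last exact: ltnW.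
rewrite evS; last by move=> i; exact: row_pt_morphism.
by rewrite Hin_row_act (@row_ptE M n N) //; exact: imx_row_supp.
Qed.

Lemma Hact_Hin M n (x : tpow B n) : act M (Hin x) = ev (row_pt M) x.
Proof.
have mr := row_pt_morphism M.
rewrite /Hact Hin_rows_act ?leq_maxl ?leq_maxr // ev_up ?leq_maxl //.
have /dl_inP[N [le1 le2 e]] : Hin (dl_repr (Hin x)) = Hin x by exact: dl_reprK.
by rewrite -(ev_up mr _ le1) e ev_up.
Qed.

Lemma Hact_morphism M : alg_morphism (act M).
Proof.
have me n := ev_morphism (row_pt_morphism M) n.
split=> [c f g|].
  have [n [x [z [_ -> ->]]]] := Hin_surj2 f g 0.
  rewrite -(amorphL (Hin_morphism B n)) !Hact_Hin.
  exact: (amorphL (me n)).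
split=> [|f g].
  by rewrite -(amorph1 (Hin_morphism B 0)) Hact_Hin (amorph1 (me 0%N)).
have [n [x [z [_ -> ->]]]] := Hin_surj2 f g 0.
rewrite -(amorphM (Hin_morphism B n)) !Hact_Hin.
exact: (amorphM (me n)).
Qed.

(** Linear substitution: the variable [i] is replaced by the row [i] of [M]. *)
Lemma Hact_emb M i b : act M (emb i b) = row_pt M i b.
Proof.
have mr := row_pt_morphism M.
by rewrite /emb Hact_Hin evS // (amorph1 (ev_morphism mr i)) mul1r.
Qed.

Lemma pt_push_sum (I : Type) (s : seq I) (F : I -> points Bsc H)
  (C : comAlgType K) (h : H -> C) (mh : alg_morphism h) :
  pt_push mh (\sum_(i <- s) F i) = \sum_(i <- s) pt_push mh (F i).
Proof.
apply: (big_morph (pt_push mh)) => [x y|]; apply: points_eq => b /=.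
  rewrite /copair (linear_tlift _ (amorphL mh)); last first.
    by apply: mul_bilin; exact: pt_linear.
  by apply: tlift_eq => u v; rewrite (amorphM mh).
exact: (amorphA _ mh).
Qed.

Lemma pt_pushD (C : comAlgType K) (h : H -> C) (mh : alg_morphism h)
  (x y : points Bsc H) : pt_push mh (x + y) = pt_push mh x + pt_push mh y.
Proof.
by have := pt_push_sum [:: x; y] id mh; rewrite !big_cons !big_nil !addr0.
Qed.

Lemma pt_pushZ (C : comAlgType K) (h : H -> C) (mh : alg_morphism h) c
  (x : points Bsc H) : pt_push mh (c *: x) = c *: pt_push mh x.
Proof. exact: points_eq. Qed.

Definition hact M := pt_push (Bsc := Bsc) (Hact_morphism M).

Lemma hactE M (x : points Bsc H) b : hact M x b = act M (x b).
Proof. by []. Qed.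

Lemma hact_emb_pt M i : hact M (emb_pt i) = row_pt M i.
Proof. by apply: points_eq => b; exact: Hact_emb. Qed.

Lemma hactD M x y : hact M (x + y) = hact M x + hact M y.
Proof. exact: pt_pushD. Qed.
Lemma hactZ M c x : hact M (c *: x) = c *: hact M x.
Proof. exact: pt_pushZ. Qed.

(** Naturality of the vector space structure makes the substitution linear, so
    that it composes by the product of matrices. *)
Lemma hact_row_pt M N i : hact N (row_pt M i) = row_pt (imx_mul M N) i.
Proof.
set n := maxn i.+1
  (maxn (imx_bound M) (maxn (imx_bound N) (imx_bound (imx_mul M N)))).
have [ltin Mn Nn MNn] : [/\ (i < n)%N, (imx_bound M <= n)%N,
    (imx_bound N <= n)%N & (imx_bound (imx_mul M N) <= n)%N].
  by rewrite !leq_max !leqnn !orbT.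
rewrite (@row_ptE M i n); last exact: imx_row_supp.
rewrite (@row_ptE (imx_mul M N) i n); last exact: imx_row_supp.
rewrite /lincomb [LHS]pt_push_sum.
transitivity (\sum_(k < n) M i k *: \sum_(j < n) N k j *: emb_pt j).
  apply: eq_bigr => k _; rewrite [LHS]hactZ hact_emb_pt (@row_ptE N k n) //.
  exact: imx_row_supp.
under eq_bigr do rewrite scaler_sumr.
rewrite exchange_big; apply: eq_bigr => j _.
rewrite /= (@imx_mul_sumE _ M (fun k => N k j) n) // scaler_suml.
by apply: eq_bigr => k _; rewrite scalerA.
Qed.

Lemma Hact_eq (h : H -> H) M : alg_morphism h ->
  (forall i b, h (emb i b) = row_pt M i b) -> act M =1 h.
Proof.
move=> mh e; apply: Hlim_eq => //; first exact: Hact_morphism.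
by move=> i b; rewrite Hact_emb e.
Qed.

Lemma lincomb1 c p n : (p < n)%N ->
  lincomb (fun j => c * (j == p)%:R) n = c *: emb_pt p.
Proof.
move=> pn; rewrite /lincomb (bigD1 (Ordinal pn)) //= eqxx mulr1 big1 ?addr0 //.
by move=> j jp; rewrite -[p]/(val (Ordinal pn)) val_eqE (negPf jp) mulr0 scale0r.
Qed.

Lemma row_pt_two (M : imatrix K) i c p d q :
  (forall j, M i j = c * (j == p)%:R + d * (j == q)%:R) ->
  row_pt M i = c *: emb_pt p + d *: emb_pt q.
Proof.
move=> Me; set n := (maxn p q).+1.
have pn : (p < n)%N by rewrite ltnS leq_maxl.
have qn : (q < n)%N by rewrite ltnS leq_maxr.
rewrite (@row_ptE M i n) => [|j nj]; last first.
  rewrite Me !gtn_eqF ?mulr0 ?addr0 //; exact: leq_trans nj.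
rewrite -(lincomb1 c pn) -(lincomb1 d qn) /lincomb -big_split /=.
by apply: eq_bigr => j _; rewrite Me scalerDl.
Qed.

Lemma row_pt_one (M : imatrix K) i p :
  (forall j, M i j = (j == p)%:R) -> row_pt M i = emb_pt p.
Proof.
move=> Me; rewrite (@row_pt_two M i 1 p 0 p) ?scale1r ?scale0r ?addr0 // => j.
by rewrite Me mul1r mul0r addr0.
Qed.

Lemma gen_ptD (S : pred nat) (x y : points Bsc H) :
  (forall b, gen S (x b)) -> (forall b, gen S (y b)) ->
  forall b, gen S ((x + y) b).
Proof.
move=> gx gy b; rewrite ptDE.
have lc : linear (copair x y) by apply: copair_linear; exact: pt_linear.
elim/tensor_ind: (Delta b) => [|u v hu hv|u v].
- by rewrite (lin0 lc); exact: gen0.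
- by rewrite (linD lc); exact: genD.
- by rewrite copair_tens; [exact: genM|exact: pt_linear..].
Qed.

(** A linear form only involves the variables with nonzero coefficient. *)
Lemma gen_row_pt (S : pred nat) (M : imatrix K) i b :
  (forall j, M i j != 0 -> S j) -> gen S (row_pt M i b).
Proof.
move=> MS; rewrite /row_pt /lincomb; move: b.
elim/big_ind: _ => [b|x y|j _ b]; [exact: genA|exact: gen_ptD|].
have [->|/MS Sj] := eqVneq (M i j) 0; last exact: gen_emb.
by rewrite scale0r; exact: genA.
Qed.

Lemma Hact_id_gen (S : pred nat) M f :
  (forall i, S i -> row_pt M i = emb_pt i) -> gen S f -> act M f = f.
Proof.
move=> rM gf; apply: (@eq_on_gen K B S H (act M) id f _ _ _ gf) => // [|i b Si].
  exact: Hact_morphism.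
by rewrite Hact_emb rM.
Qed.

(** A substitution that neither changes the variable [i] nor introduces it into
    the other variables commutes with every operator on the variable [i]. *)
Lemma Hint_Hact (Q : B -> B) i M f : linear Q -> row_pt M i = emb_pt i ->
  (forall j b, j != i -> gen (predC1 i) (row_pt M j b)) ->
  Hint Q i (act M f) = act M (Hint Q i f).
Proof.
move=> lQ Mi Mj; have mM := Hact_morphism M.
have lH := Hint_linear i lQ.
elim/(@Hlim_ind1 K B i): f => [f g IHf IHg|r a gr].
  rewrite (linD (amorphL mM)) !(linD lH).
  by rewrite (linD (amorphL mM)) IHf IHg.
have gMr : gen (predC1 i) (act M r).
  apply: gen_morph mM _ gr => j b ji; rewrite Hact_emb; exact: Mj.
rewrite (amorphM mM) Hint_tens // (amorphM mM) !Hact_emb Mi.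
exact: Hint_tens.
Qed.

(** * The induced hierarchy *)

Lemma Hlim_hierarchy : hierarchy (@Hlevel K B) act.
Proof.
have mono n (f : H) : Hlevel n f -> Hlevel n.+1 f.
  by move/HlevelP => gf; apply/HlevelP; apply: gen_mono gf => i; exact: leqW.
split=> //.
- apply/seteqP; split=> f; first by case=> c _ <-; exists c; exact: Hin0.
  by case=> c ->; exists c => //; exact: Hin0.
- move=> n; split=> [|c f g|f g]; first by apply/HlevelP; exact: gen1.
    move=> /HlevelP gf /HlevelP gg; apply/HlevelP; apply: genD gg.
    exact: genZ.
  by move=> /HlevelP gf /HlevelP gg; apply/HlevelP; exact: genM.
- by move=> f; have [n [x [_ ->]]] := Hin_surj f 0; exists n; exists x.
- exact: Hact_morphism.
- move=> f; apply: Hact_id_gen (gen_all f) => i _.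
  by apply: row_pt_one => j; rewrite /= eq_sym.
- move=> M N f; apply: (@Hact_eq (act N \o act M)).
    by apply: alg_morphism_comp; exact: Hact_morphism.
  by move=> i b /=; rewrite Hact_emb -hactE hact_row_pt.
- move=> n M f /HlevelP gf; apply: eq_on_gen gf; [exact: Hact_morphism..|].
  move=> i b ltin; rewrite !Hact_emb; congr (pt_fun _ b).
  by apply: row_pt_ext => j /=; rewrite ltin.
- move=> n M f /HlevelP gf; apply/HlevelP.
  apply: gen_morph (Hact_morphism _) _ gf => i b ltin.
  rewrite Hact_emb; apply: gen_row_pt => j; rewrite /= /imx_mx_fun.
  case: insubP => [i' _ _|]; last by rewrite ltin.
  case: insubP => [j' ltjn _ //|_].
  by have [<- _|] := eqVneq i j; rewrite // eqxx.
- move=> n f /HlevelP gf; apply/HlevelP.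
  apply: gen_morph (Hact_morphism _) _ gf => i b ltin.
  rewrite Hact_emb; apply: gen_row_pt => j /=.
  have [<-|_] := eqVneq i j; last by rewrite eqxx.
  have [_|ne _] := eqVneq i n; first by rewrite eqxx.
  by rewrite ltn_neqAle ne -ltnS.
Qed.
End Action.

(** * Ordinary Rota-Baxter operators *)

Section OrdinaryRB.
Variables (K : fieldType) (B : comAlgType K) (e P : B -> B).
Hypothesis OP : ordinary_rota_baxter (@constants K B) [set: B] P.
Hypothesis eP : evaluation_of (@constants K B) [set: B] P e.

Lemma ordinary_linear : linear P.
Proof.
move=> c x y; rewrite -mulr_algl (orb_linear OP) ?mulr_algl //.
by exists c.
Qed.

Lemma evaluation_int b : e (P b) = 0.
Proof.
rewrite -[P b]add0r eP //; by exists 0; rewrite scale0r.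
Qed.

(** Injectivity of [P] on B does not by itself pass to tensor products, but a
    linear left inverse does; the decomposition of B provides one, together
    with a resolution of the identity. *)
Lemma ordinary_left_inverse : exists Q : B -> B,
  [/\ linear Q, cancel P Q & forall b, b = e b + P (Q b)].
Proof.
have ex b : exists f, b = e b + P f.
  have [r [f [rK _ ->]]] := orb_sum OP (I : [set: B]%classic b).
  by exists f; rewrite eP.
pose Q b := sval (cid (ex b)).
have QP b : b = e b + P (Q b) by exact: svalP (cid (ex b)).
have injP : injective P by move=> x y; exact: (orb_inj OP).
have PQ : cancel P Q.
  by move=> b; apply: injP; rewrite [RHS](QP (P b)) evaluation_int add0r.
have ek b : constants (e b).
  have [r [f [rK _ ->]]] := orb_sum OP (I : [set: B]%classic b).
  by rewrite eP.
have eQ r b : constants r -> Q (r + P b) = b.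
  move=> rK; apply: injP; apply: (addrI r).
  by rewrite [RHS](QP (r + P b)) eP.
exists Q; split=> // c x y.
rewrite {1}(QP x) {1}(QP y) scalerDr addrACA.
rewrite -ordinary_linear eQ //.
have [a ->] := ek x; have [d ->] := ek y.
by exists (c * a + d); rewrite scalerDl scalerA.
Qed.
End OrdinaryRB.

(** * Integrals of the induced hierarchy *)

Section RBHierarchy.
Variables (K : fieldType) (B : comAlgType K).
Variables (Delta : B -> tensor B B) (eps : B -> K^o).
Variables (P : B -> B) (sc : K -> B -> B).
Variable Bsc : scaled_rota_baxter_bialgebra Delta eps P sc.
Local Notation H := (Hlim B).
Local Notation emb := (@emb K B).
Local Notation act := (Hact Delta eps sc).
Local Notation int := (@Hint K B P).
Local Notation e := (bi_e eps).
Local Notation emb_pt := (emb_pt Bsc).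
Local Notation row_pt := (row_pt Bsc).

Let Brb : rota_baxter_bialgebra Delta eps P := srbb_rbb Bsc.
Let Bbi : bialgebra Delta eps := rbb_bialgebra Brb.
Let OP := rbb_ordinary Brb.
Let eP := rbb_evaluation Brb.
Let leps : linear eps := amorphL (bialg_counit Bbi).
Let lP : linear P := ordinary_linear OP.
Let rbP x y : P x * P y = P (x * P y) + P (P x * y).
Proof. exact: (orb_axiom OP). Qed.
Let le : linear e.
Proof. by move=> c x y; rewrite /bi_e leps scalerDl scalerA. Qed.
Let embD i : {morph emb i : x y / x + y} := linD (amorphL (emb_morphism B i)).
Let embM i : {morph emb i : x y / x * y} := amorphM (emb_morphism B i).

Lemma gen_predC1 i j b : j != i -> gen (predC1 i) (emb j b).
Proof. by move=> ji; exact: gen_emb. Qed.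

Lemma Hint_comp (Q R : B -> B) i f : linear Q -> linear R ->
  Hint Q i (Hint R i f) = Hint (Q \o R) i f.
Proof.
move=> lQ lR.
have lQR : linear (Q \o R) by exact: linear_comp.
elim/(@Hlim_ind1 K B i): f => [f g IHf IHg|r a gr].
  by rewrite (linD (Hint_linear i lR)) !(linD (Hint_linear i _)) // IHf IHg.
by rewrite !Hint_tens.
Qed.

Lemma Hint_id i f : Hint id i f = f :> H.
Proof.
elim/(@Hlim_ind1 K B i): f => [f g IHf IHg|r a gr].
  by rewrite (linD (Hint_linear i _)) // IHf IHg.
by rewrite Hint_tens.
Qed.

Lemma Hint_add (Q R : B -> B) i f : linear Q -> linear R ->
  Hint (fun b => Q b + R b) i f = Hint Q i f + Hint R i f.
Proof.
move=> lQ lR.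
have lQR : linear (fun b => Q b + R b).
  by move=> c x y; rewrite lQ lR scalerDr addrACA.
elim/(@Hlim_ind1 K B i): f => [f g IHf IHg|r a gr].
  rewrite (linD (Hint_linear i lQR)) (linD (Hint_linear i lQ)).
  by rewrite (linD (Hint_linear i lR)) IHf IHg addrACA.
by rewrite !Hint_tens // embD mulrDr.
Qed.

Lemma Hint_rota_baxter i : rota_baxter_operator (int i).
Proof.
have lH := Hint_linear i lP.
split=> // f g.
elim/(@Hlim_ind1 K B i): f => [f f' IH IH'|r a gr].
  by rewrite !mulrDl !(linD lH) mulrDl IH IH' mulrDl (linD lH) addrACA.
elim/(@Hlim_ind1 K B i): g => [g g' IH IH'|s b gs].
  by rewrite !mulrDr !(linD lH) mulrDr IH IH' !mulrDr !(linD lH) addrACA.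
have grs : gen (predC1 i) (r * s) by exact: genM.
by rewrite !Hint_tens // !(mulrACA r _ s) -!embM !Hint_tens // -mulrDr -embD rbP.
Qed.

Lemma Hint_commute (Q R : B -> B) (i k : nat) f : linear Q -> linear R -> i != k ->
  Hint Q i (Hint R k f) = Hint R k (Hint Q i f).
Proof.
move=> lQ lR ik; have lHi := Hint_linear i lQ; have lHk := Hint_linear k lR.
elim/(@Hlim_ind2 K B i k ik): f => [f g IHf IHg|r a b gr].
  by rewrite (linD lHk) !(linD lHi) (linD lHk) IHf IHg.
have [gi gk] : gen (predC1 i) r /\ gen (predC1 k) r.
  by split; apply: gen_mono gr => j /=; rewrite negb_or => /andP[].
have Hi u v : Hint Q i (r * emb i u * emb k v) = r * emb i (Q u) * emb k v.
  rewrite mulrAC Hint_tens //; first by rewrite mulrAC.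
  by apply: genM => //; apply: gen_predC1; rewrite eq_sym.
have Hk u v : Hint R k (r * emb i u * emb k v) = r * emb i u * emb k (R v).
  by rewrite Hint_tens //; apply: genM => //; exact: gen_predC1.
by rewrite Hk !Hi Hk.
Qed.

Lemma gen_Hint (Q : B -> B) (S : pred nat) n f : linear Q -> S n ->
  gen S f -> gen S (Hint Q n f).
Proof.
move=> lQ Sn gf; elim: (gen_split n gf) => {f gf} [r a gr|f g _ hf _ hg].
  rewrite Hint_tens //; last by apply: gen_mono gr => j /andP[].
  by apply: genM; [apply: gen_mono gr => j /andP[]|exact: gen_emb].
by rewrite (linD (Hint_linear n lQ)); exact: genD.
Qed.

Lemma row_pt_E (n i : nat) : row_pt (imx_E n) i = if i == n then 0 else emb_pt i.
Proof.
have [->|ne] := eqVneq i n.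
  rewrite (@row_pt_two _ _ _ _ _ _ Bsc _ n 0 0 0 0) ?scale0r ?addr0 // => j /=.
  by rewrite !mul0r addr0 eqxx andbF.
by apply: row_pt_one => j /=; rewrite ne andbT eq_sym.
Qed.

(** The matrix E_n substitutes the zero point, that is the counit, for its
    variable. *)
Lemma Hact_E n f : act (imx_E n) f = Hint e n f.
Proof.
have mA := Hact_morphism Bsc (imx_E n).
elim/(@Hlim_ind1 K B n): f => [f g IHf IHg|r a gr].
  by rewrite (linD (amorphL mA)) (linD (Hint_linear n le)) IHf IHg.
rewrite Hint_tens // (amorphM mA) (Hact_emb Bsc) row_pt_E eqxx pt0E.
rewrite (Hact_id_gen (Bsc := Bsc) _ gr) => [|i /= ni]; last first.
  by rewrite row_pt_E (negPf ni).
by rewrite /bi_e (amorphA _ (emb_morphism B n)).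
Qed.

Lemma gen_lt_predC1 n r : gen (fun i => (i < n)%N) r -> gen (predC1 n) (r : H).
Proof. by apply: gen_mono => i; rewrite /= ltn_neqAle => /andP[]. Qed.

Lemma Hlim_evaluation n :
  evaluation_of (@Hlevel K B n) (Hlevel n.+1) (int n) (act (imx_E n)).
Proof.
move=> r f /HlevelP/gen_lt_predC1 gr _; rewrite Hact_E (linD (Hint_linear n le)).
have -> : Hint e n (int n f) = 0.
  rewrite Hint_comp //; elim/(@Hlim_ind1 K B n): f => [f g IHf IHg|s a gs].
    rewrite (linD (Hint_linear n _)) ?IHf ?IHg ?addr0 //.
    exact: linear_comp.
  rewrite Hint_tens //=; last exact: linear_comp.
  by rewrite evaluation_int // (lin0 (amorphL (emb_morphism B n))) mulr0.
rewrite addr0 -[r]mulr1 Hint_genM // -{1}(amorph1 (emb_morphism B n)).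
rewrite -[emb n 1]mul1r Hint_tens //; last exact: gen1.
rewrite mul1r /bi_e (amorph1 (bialg_counit Bbi)) scale1r.
by rewrite (amorph1 (emb_morphism B n)).
Qed.

(** Applying the left inverse and the resolution of the identity to the
    variable [n] gives injectivity and the decomposition of the level [n.+1]. *)
Lemma Hlim_ordinary n : ordinary_rota_baxter (@Hlevel K B n) (Hlevel n.+1) (int n).
Proof.
have [Q [lQ PQ eQ]] := ordinary_left_inverse OP eP.
have lH := Hint_linear n lP.
have QP f : Hint Q n (int n f) = f.
  rewrite Hint_comp // -[RHS](Hint_id n); congr (Hint _ n f).
  by apply/funext => b /=; rewrite PQ.
split.
- exact: (hier_incl (Hlim_hierarchy Bsc)).
- by move=> f /HlevelP gf; apply/HlevelP; apply: gen_Hint.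
- move=> r f g /HlevelP/gen_lt_predC1 gr _ _.
  by rewrite (linD lH) Hint_genM.
- by move=> f g _ _; exact: (rbo_axiom (Hint_rota_baxter n)).
- by move=> f g _ _ /(congr1 (Hint Q n)); rewrite !QP.
- move=> f hf; exists (act (imx_E n) f), (Hint Q n f); split.
  + exact: (hier_eval (Hlim_hierarchy Bsc)).
  + by move/HlevelP: hf => gf; apply/HlevelP; apply: gen_Hint.
  + rewrite Hact_E Hint_comp // -Hint_add //; last exact: linear_comp.
    rewrite -[LHS](Hint_id n); congr (Hint _ n f).
    by apply/funext => b; exact: eQ.
- move=> r f hr hf rP.
  have hz : Hlevel n (0 : H) by apply/HlevelP; exact: gen0.
  have h0 : Hlevel n.+1 (0 : H) by apply/HlevelP; exact: gen0.
  have := Hlim_evaluation hr h0; rewrite (lin0 lH) addr0 => <-.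
  by have := Hlim_evaluation hz hf; rewrite add0r -rP.
Qed.

Lemma Hint_shift n m (M : imatrix K) f : (n < m)%N ->
  int n (act (imx_shift m M) f) = act (imx_shift m M) (int n f).
Proof.
move=> nm.
have row_lt i : (i < m)%N -> row_pt (imx_shift m M) i = emb_pt i.
  by move=> im; apply: row_pt_one => j /=; rewrite leqNgt im /= eq_sym.
apply: (Hint_Hact (Bsc := Bsc)) => // [|j b jn]; first exact: row_lt.
have [jm|mj] := ltnP j m; first by rewrite row_lt //; exact: gen_predC1.
apply: gen_row_pt => k /=; rewrite mj; apply: contra => /eqP ->.
by rewrite leqNgt nm /= (gtn_eqF (leq_trans nm mj)).
Qed.

Lemma row_pt_swap (p q i : nat) :
  row_pt (imx_swap p q) i = emb_pt (if i == p then q else if i == q then p else i).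
Proof. by apply: row_pt_one => j. Qed.

Lemma Hint_swap i k f : i != k ->
  act (imx_swap i k) (int i f) = int k (act (imx_swap i k) f).
Proof.
move=> ik; have mA := Hact_morphism Bsc (imx_swap i k).
have lHi := Hint_linear i lP; have lHk := Hint_linear k lP.
elim/(@Hlim_ind1 K B i): f => [f g IHf IHg|r a gr].
  by rewrite (linD lHi) !(linD (amorphL mA)) (linD lHk) IHf IHg.
have gkr : gen (predC1 k) (act (imx_swap i k) r).
  apply: gen_morph mA _ gr => j b /= ji; rewrite (Hact_emb Bsc) row_pt_swap.
  rewrite (negPf ji); apply: gen_predC1.
  by have [_|] := eqVneq j k.
by rewrite Hint_tens // !(amorphM mA) !(Hact_emb Bsc) row_pt_swap eqxx Hint_tens.
Qed.

Lemma row_pt_scal c (i : nat) :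
  row_pt (imx_scal c) i = if i == 0%N then c *: emb_pt 0 else emb_pt i.
Proof.
case: i => [|i] /=.
  rewrite (@row_pt_two _ _ _ _ _ _ Bsc _ 0 c 0 0 0) ?scale0r ?addr0 // => -[|j] /=.
    by rewrite mulr1 mul0r addr0.
  by rewrite mulr0 mul0r addr0.
by apply: row_pt_one => j /=; rewrite eq_sym.
Qed.

Lemma Hint_scal c f : c != 0 ->
  int 0 (act (imx_scal c) f) = c^-1 *: act (imx_scal c) (int 0 f).
Proof.
move=> c0; have mA := Hact_morphism Bsc (imx_scal c).
have lH := Hint_linear 0 lP.
elim/(@Hlim_ind1 K B 0): f => [f g IHf IHg|r a gr].
  by rewrite !(linD (amorphL mA), linD lH) IHf IHg scalerDr.
have act_r : act (imx_scal c) r = r.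
  by apply: (Hact_id_gen (Bsc := Bsc) _ gr) => -[|i] // _; rewrite row_pt_scal.
rewrite Hint_tens // !(amorphM mA) !(Hact_emb Bsc) row_pt_scal /= act_r.
rewrite /scaling0 (negPf c0) Hint_tens // (scal_int (srbb_scaling Bsc)) //.
by rewrite (linZ _ (amorphL (emb_morphism B 0))) scalerAr.
Qed.

(** * Integrals and transvections *)

Local Notation emb2 i k := (copair (emb i) (emb k)).

Lemma emb2_linear i k : linear (emb2 i k).
Proof. by apply: copair_linear; apply: amorphL; exact: emb_morphism. Qed.

Lemma emb2_tens i k u v : emb2 i k (u \ox v) = emb i u * emb k v.
Proof. by apply: copair_tens; apply: amorphL; exact: emb_morphism. Qed.

(** For [t = Delta b] the argument is b evaluated at the sum of the variables
    [i] and [k]; only the first of them is integrated. *)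
Lemma Hint_emb2 (Q : B -> B) i k t : i != k -> linear Q ->
  Hint Q i (emb2 i k t) = emb2 i k (tmap Q id t).
Proof.
move=> ik lQ; move: t; apply: tensor_linear_ext => [||u v].
- exact: (linear_comp (Hint_linear i lQ) (emb2_linear i k)).
- by apply: (linear_comp (emb2_linear i k)); exact: tmap_linear.
rewrite tmap_tens // !emb2_tens mulrC Hint_tens; [exact: mulrC|exact: lQ|].
by apply: gen_predC1; rewrite eq_sym.
Qed.

Lemma row_pt_T1 (i : nat) : row_pt imx_T1 i =
  if i == 0%N then emb_pt 0 + emb_pt 1 else emb_pt i.
Proof.
case: i => [|i] /=.
  rewrite (@row_pt_two _ _ _ _ _ _ Bsc _ 0 1 0 1 1) ?scale1r // => j /=.
  by rewrite !mul1r eq_sym.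
by apply: row_pt_one => j /=; rewrite addr0 eq_sym.
Qed.

(** On [r * emb 0 a] the claim is the image of
    [Delta (P a) - (e (x) id) (Delta (P a)) = (P (x) id) (Delta a)]
    under [emb2 0 1]. *)
Lemma Hint_T1 f : int 0 (act imx_T1 f) =
  act imx_T1 (int 0 f) - act (imx_E 0) (act imx_T1 (int 0 f)).
Proof.
rewrite Hact_E; have mA := Hact_morphism Bsc imx_T1.
have lH := Hint_linear 0 lP; have lHe := Hint_linear 0 le.
elim/(@Hlim_ind1 K B 0): f => [f g IHf IHg|r a gr].
  by rewrite !(linD (amorphL mA), linD lH, linD lHe) IHf IHg opprD addrACA.
have act_r : act imx_T1 r = r.
  by apply: (Hact_id_gen (Bsc := Bsc) _ gr) => -[|i] // _; rewrite row_pt_T1.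
rewrite Hint_tens // !(amorphM mA) !(Hact_emb Bsc) row_pt_T1 /= act_r.
rewrite !Hint_genM // !Hint_emb2 // -mulrBr -(linB (emb2_linear 0 1)).
by rewrite {1}(rbb_comult Brb) addrK.
Qed.

(** The multiple of the variable [i] that L_(i+1)(w) adds to the variable [k]. *)
Definition Lcoef i m (w : 'cV[K]_m) k : K :=
  \sum_(p < m) w p 0 * (k == i.+1 + p)%N%:R.

Lemma row_pt_L i m (w : 'cV[K]_m) k :
  row_pt (imx_L i w) k = emb_pt k + Lcoef i w k *: emb_pt i.
Proof.
rewrite (@row_pt_two _ _ _ _ _ _ Bsc _ k 1 k (Lcoef i w k) i) ?scale1r // => j /=.
rewrite mul1r eq_sym mulr_suml; congr (_ + _); apply: eq_bigr => p _.
by rewrite -mulrA -natrM mulnb.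
Qed.

Lemma Lcoef_le i m (w : 'cV[K]_m) k : (k <= i)%N -> Lcoef i w k = 0.
Proof.
move=> ki; rewrite /Lcoef big1 // => p _.
by rewrite ltn_eqF ?mulr0 // addSn ltnS (leq_trans ki) // leq_addr.
Qed.

Lemma LcoefN i m (w : 'cV[K]_m) k : Lcoef i (- w) k = - Lcoef i w k.
Proof.
by rewrite /Lcoef -sumrN; apply: eq_bigr => p _; rewrite mxE mulNr.
Qed.

Lemma LcoefD i m (w w' : 'cV[K]_m) k :
  Lcoef i (w + w') k = Lcoef i w k + Lcoef i w' k.
Proof.
by rewrite /Lcoef -big_split; apply: eq_bigr => p _; rewrite mxE mulrDl.
Qed.

Lemma Lcoef_delta i m k :
  Lcoef i (delta_mx 0 0 : 'cV[K]_(1 + m)) k = (k == i.+1)%:R.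
Proof.
rewrite /Lcoef (bigD1 ord0) //= mxE !eqxx mul1r addn0 big1 ?addr0 // => p p0.
by rewrite mxE (negPf p0) mul0r.
Qed.

Lemma Lcoef_col0 i m (v : 'cV[K]_m) k :
  Lcoef i (col_mx (0 : 'cV_1) v) k = Lcoef i.+1 v k.
Proof.
rewrite /Lcoef big_split_ord big_ord1 /= col_mxEu mxE mul0r add0r.
by apply: eq_bigr => p _; rewrite col_mxEd addnA addn1.
Qed.

(** On the variable [k], with [c] the entry of [v] belonging to [k]
    (zero for [k <= 1]), the three
    substitutions give x_k + c x_1, then x_k + x_0 [k = 1] + c (x_1 + x_0),
    and finally x_k + x_0 [k = 1] + c x_0 (variables numbered from 0). *)
Lemma Hact_L_conj m (v : 'cV[K]_m) f :
  act (imx_L 0 ((delta_mx 0 0 : 'cV_(1 + m)) + col_mx 0 v)) f =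
  act (imx_L 1 (- v)) (act (imx_L 0 (delta_mx 0 0 : 'cV_(1 + m)))
    (act (imx_L 1 v) f)).
Proof.
set W := imx_L 0 (_ + _); set A := imx_L 0 _.
set S := imx_L 1 v; set S' := imx_L 1 _.
apply: (Hact_eq (Bsc := Bsc) (h := act S' \o (act A \o act S))).
  apply: alg_morphism_comp; first exact: (Hact_morphism Bsc).
  by apply: alg_morphism_comp; exact: (Hact_morphism Bsc).
move=> i b /=; rewrite (Hact_emb Bsc) -!hactE; congr (pt_fun _ b).
rewrite /W /S /A /S' !(row_pt_L, hactD, hactZ, hact_emb_pt) LcoefD Lcoef_col0.
rewrite !Lcoef_delta LcoefN eqxx scale1r !(@Lcoef_le 1 _ (- v)) //.
rewrite !scale0r !addr0 scaleNr scalerDr scalerDl -!addrA; congr (_ + _).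
by rewrite [_ + (_ *: _ + _)]addrCA addKr.
Qed.

Lemma Hint0_L1 m (v : 'cV[K]_m) f :
  int 0 (act (imx_L 1 v) f) = act (imx_L 1 v) (int 0 f).
Proof.
apply: (Hint_Hact (Bsc := Bsc)) => // [|j b j0].
  by rewrite row_pt_L Lcoef_le // scale0r addr0.
rewrite row_pt_L; apply: gen_ptD => {}b; first exact: gen_predC1.
exact: gen_predC1.
Qed.

(** On [r * emb 0 a * emb 1 b] the right-hand side applies the compatibility of
    [Delta] with [P] to [Delta (P b)].  Its boundary term [1 (x) P b] contributes
    equally to both parts and cancels; for a tensor [u (x) v] in place of
    [Delta b], what remains is
    [P (P a * u) = P a * P u - P (a * P u)], the Rota-Baxter axiom. *)
Lemma Hint_L_e1 m f (A := imx_L 0 (delta_mx 0 0 : 'cV[K]_(1 + m))) :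
  int 0 (act A (int 0 f)) = act A (int 0 (int 1 f)) - int 0 (act A (int 1 f)).
Proof.
have mA := Hact_morphism Bsc A.
have lH0 := Hint_linear 0 lP; have lH1 := Hint_linear 1 lP.
elim/(@Hlim_ind2 K B 0 1 isT): f => [f g IHf IHg|r a b gr].
  rewrite !(linD (amorphL mA), linD lH0, linD lH1) IHf IHg opprD.
  by rewrite addrACA.
have gr0 : gen (predC1 0) r by apply: gen_mono gr => -[].
have gr1 : gen (predC1 1) r by apply: gen_mono gr => -[|[]].
have rowA i : row_pt A i = emb_pt i + (i == 1%N)%:R *: emb_pt 0.
  by rewrite row_pt_L Lcoef_delta.
have actr : act A r = r.
  apply: (Hact_id_gen (Bsc := Bsc) _ gr) => -[|[|i]] // _.
  by rewrite rowA scale0r addr0.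
have act0 u : act A (emb 0 u) = emb 0 u.
  by rewrite (Hact_emb Bsc) rowA scale0r addr0.
have act1 u : act A (emb 1 u) = emb2 0 1 (Delta u).
  by rewrite (Hact_emb Bsc) rowA scale1r addrC.
have int0 u v : int 0 (r * emb 0 u * emb 1 v) = r * emb 0 (P u) * emb 1 v.
  rewrite mulrAC Hint_tens //; first by rewrite mulrAC.
  by apply: genM => //; exact: gen_predC1.
have int1 u v : int 1 (r * emb 0 u * emb 1 v) = r * emb 0 u * emb 1 (P v).
  by rewrite Hint_tens //; apply: genM => //; exact: gen_predC1.
rewrite int0 int1 int0 !(amorphM mA) actr !act0 !act1 (rbb_comult Brb).
set T := tmap P id (Delta b); set E := tmap e id _.
have lE := emb2_linear 0 1.
have -> : E = 1 \ox P b by exact: (tmap_counitl Bsc).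
rewrite (linD lE) !mulrDr emb2_tens (amorph1 (emb_morphism B 0)) mul1r.
rewrite (linD lH0) int0 opprD addrACA subrr addr0 /T.
have lA (s : H) : linear (fun t => s * emb2 0 1 t).
  by move=> c x y; rewrite lE mulrDr scalerAr.
have lT : linear (tmap P (@id B)) by exact: tmap_linear.
move: (Delta b); apply: tensor_linear_ext => [||u v].
- exact: (linear_comp lH0 (lA _)).
- move=> c x y; rewrite lT (lA (r * emb 0 (P a))) (lA (r * emb 0 a)) lH0.
  by rewrite opprD addrACA scalerBr.
rewrite tmap_tens // !emb2_tens !mulrA -!(mulrA r (emb 0 _)) -!embM !int0.
by rewrite -mulrBl -mulrBr -(linB (amorphL (emb_morphism B 0))) rbP addrC addKr.
Qed.

Lemma Hint_L m (v : 'cV[K]_m) f :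
  let e1 : 'cV[K]_(1 + m) := delta_mx 0 0 in
  let v0 : 'cV[K]_(1 + m) := col_mx 0 v in
  let bracket g := act (imx_L 0 e1) (int 0 g) - int 0 (act (imx_L 0 e1) g) in
  int 0 (act (imx_L 0 (e1 + v0)) (int 0 f)) =
  act (imx_L 1 (- v)) (bracket (int 1 (act (imx_L 1 v) f))).
Proof.
by move=> e1 v0 bracket; rewrite Hact_L_conj Hint0_L1 -(Hint0_L1 v) Hint_L_e1.
Qed.

Lemma Hlim_rota_baxter_hierarchy :
  rota_baxter_hierarchy (@Hlevel K B) act (Hint P).
Proof.
split.
- exact: Hlim_hierarchy Bsc.
- exact: Hint_rota_baxter.
- by move=> i k f; have [->//|ik] := eqVneq i k; exact: Hint_commute.
- move=> n m f nm /HlevelP gf; apply/HlevelP.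
  exact: gen_Hint.
- exact: Hint_shift.
- exact: Hlim_ordinary.
- exact: Hlim_evaluation.
- exact: Hint_swap.
- exact: Hint_scal.
- exact: Hint_T1.
- exact: Hint_L.
Qed.
End RBHierarchy.

Theorem theorem3p7 (K : fieldType) (charK : [pchar K] =i pred0)
    (B : comAlgType K) (Delta : B -> tensor B B) (eps : B -> K^o)
    (P : B -> B) (sc : K -> B -> B) :
  scaled_rota_baxter_bialgebra Delta eps P sc ->
  rota_baxter_hierarchy (@Hlevel K B) (Hact Delta eps sc) (Hint P).
Proof. exact: Hlim_rota_baxter_hierarchy. Qed.
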